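(* Suppose that each $f_i$ ($i\in\mathcal I$) is convex and $L$-smooth for some $L\in(0,+\infty)$, and that $\sigma_*^2<+\infty$. Let $\gamma>0$ with $\gamma L\in(1,2)$, let $x_0\in\mathcal H$, let $(x_t)_{t\ge 0}$ be generated by SGD with step-size $\gamma$, and let $x_*\in\operatorname{argmin} f$. Then, for every $\varepsilon\in(0,1)$ and every integer $T\ge1$, with $\bar x_T=\frac1T\sum_{t=0}^{T-1}x_t$, $$\mathbb E\left[f(\bar x_T)-\min f\right]\le\frac1T\sum_{t=0}^{T-1}\mathbb E\left[f(x_t)-\min f\right]\le\frac{\|x_0-x_*\|^2}{2\gamma(1-\varepsilon)(2-\gamma L)T}+\frac{\gamma L+\varepsilon(2-\gamma L)}{2\varepsilon(1-\varepsilon)(2-\gamma L)^2}\gamma\sigma_*^2.$$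
   Context: Problem setting: $\mathcal H$ is a real Hilbert space, $\mathcal D$ is a probability distribution over a (possibly infinite) index set $\mathcal I$, and $(f_i)_{i\in\mathcal I}$ is a family of differentiable functions $f_i:\mathcal H\to\mathbb R$. For every $x\in\mathcal H$, $i\mapsto f_i(x)$ is $\mathcal D$-measurable with finite expectation; $f(x):=\mathbb E_{i\sim\mathcal D}[f_i(x)]$; $\operatorname{argmin} f\neq\emptyset$; $f$ is differentiable and $\nabla f(x)=\mathbb E[\nabla f_i(x)]$. A function is $L$-smooth if its gradient is $L$-Lipschitz continuous. The solution gradient variance is $\sigma_*^2:=\inf_{x_*\in\operatorname{argmin} f}\mathbb E\left[\|\nabla f_i(x_* )\|^2\right]$. SGD with step-size $\gamma$: $x_{t+1}=x_t-\gamma\nabla f_{i_t}(x_t)$, where $x_0\in\mathcal H$ is deterministic and the $i_t$ are i.i.d. with law $\mathcal D$. *)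

(* Defs.v *)
From HB Require Import structures.
From mathcomp Require Import all_boot all_order all_algebra finmap.
From mathcomp Require Import all_classical all_reals all_analysis.

Set Implicit Arguments.
Unset Strict Implicit.
Unset Printing Implicit Defensive.

Import Order.TTheory GRing.Theory Num.Theory.
Import numFieldNormedType.Exports.

Local Open Scope classical_set_scope.
Local Open Scope ring_scope.

(* A real Hilbert space is a complete normed space whose norm comes from an
   inner product; over the reals the involution of [{dot _ for _}] is [idfun]. *)
HB.mixin Record CompleteNormedModule_isHilbert (R : realType) H
    of CompleteNormedModule R H := {
  inner : {dot H for idfun} ;
  sqr_norm_inner : forall x : H, `|x| ^+ 2 = inner x x
}.

#[short(type="hilbertType")]
HB.structure Definition Hilbert (R : realType) :=
  {H of CompleteNormedModule R H & CompleteNormedModule_isHilbert R H}.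

Section Functions.
Context {R : realType} {H : hilbertType R}.
Implicit Types (g : H -> R) (x y : H).

(* The Riesz representative of the (Frechet) differential; it exists and is
   unique wherever [g] is differentiable, and the default value 0 is only
   reached where [g] is not differentiable. *)
Definition grad g x : H := xget 0 [set v | forall h, 'd g x h = inner v h].

Definition smooth (L : R) g : Prop :=
  (forall x, differentiable g x) /\ L.-lipschitz (grad g).

Definition argmin g : set H := [set x | forall y, g x <= g y].

(* Only used when [argmin g] is nonempty, where the infimum is attained. *)
Definition minimum g : R := inf (range g).

End Functions.

(* Bochner expectation of Hilbert-valued random vectors. *)
Section VectorExpectation.
Context {R : realType} {H : hilbertType R} {d : measure_display}
  {T : measurableType d} (P : probability T R).

Definition simple_vector (s : T -> H) : Prop :=
  finite_set (range s) /\ forall v, measurable (s @^-1` [set v]).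

Definition simple_expectation (s : T -> H) : H :=
  \sum_(v \in range s) fine (P (s @^-1` [set v])) *: v.

Definition has_expectation (X : T -> H) (m : H) : Prop :=
  exists s : nat -> T -> H,
    [/\ forall n, simple_vector (s n),
        {ae P, forall w, s n w @[n --> \oo] --> X w},
        ('E_P[fun w => `|X w - s n w|%R])%E @[n --> \oo] --> 0%E
      & simple_expectation (s n) @[n --> \oo] --> m].

End VectorExpectation.

Section RandomSequences.
Context {R : realType} {d d' : measure_display}
  {Omega : measurableType d} {I : measurableType d'} (P : probability Omega R).

Definition mutually_independent (X : nat -> {mfun Omega >-> I}) : Prop :=
  forall (J : {fset nat}) (A : nat -> set I), (forall t, measurable (A t)) ->
    P (\bigcap_(t in [set` J]) X t @^-1` A t)
    = (\prod_(t <- J) P (X t @^-1` A t))%E.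

Definition iid (D : probability I R) (X : nat -> {mfun Omega >-> I}) : Prop :=
  (forall t A, measurable A -> distribution P (X t) A = D A) /\
  mutually_independent X.

End RandomSequences.

Section SGD.
Context {R : realType} {H : hilbertType R} {d : measure_display}
  {I : measurableType d} (D : probability I R) (f : I -> H -> R).

Definition objective (x : H) : R := fine 'E_D[fun i => f i x].

Definition solution_grad_variance : \bar R :=
  ereal_inf [set ('E_D[fun i => (`|grad (f i) x| ^+ 2)%R])%E
            | x in argmin objective].

Fixpoint sgd {Omega : Type} (gamma : R) (x0 : H) (i : nat -> Omega -> I)
    (t : nat) (w : Omega) : H :=
  if t is s.+1 then
    let x := sgd gamma x0 i s w in x - gamma *: grad (f (i s w)) x
  else x0.

Definition average {Omega : Type} (x : nat -> Omega -> H) (T : nat)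
    (w : Omega) : H :=
  T%:R^-1 *: \sum_(t < T) x t w.

End SGD.

(* Main.v *)
Require Import Defs.
From HB Require Import structures.
From mathcomp Require Import all_boot all_order all_algebra finmap.
From mathcomp Require Import all_classical all_reals all_analysis.
From mathcomp Require Import measurable_realfun ring lra.

(** Write [a = gamma * L].  For one [L]-smooth convex [g] and any [y], the Bregman
    divergence [bregman g x y = g x - g y - <grad g y, x - y>] lies between
    [`|grad g x - grad g y| ^ 2 / (2 L)] (cocoercivity) and [L / 2 * `|x - y| ^ 2]
    (descent lemma).  Expanding the square [`|x - gamma grad g x - y| ^ 2] and using
    cocoercivity in both directions gives [gradient_step]:
<<
  |x+ - y|^2 + A bregman g x y + 2 gamma <grad g y, x - y>
    <= |x - y|^2 + gamma^2 (1 + 1/delta) |grad g y|^2,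
  A = 2 gamma (2 - a (1 + delta)).
>>
    Because [a > 1], the leftover multiple of [`|grad g x - grad g y| ^ 2] has a
    nonnegative coefficient and can be traded for the divergence.  With
    [delta = eps (2 - a) / a] one gets [A = 2 gamma (1 - eps) (2 - a)].

    At a minimizer [xs], optimality makes the mean of [<grad (f i) xs, h>] vanish for
    every [h], so the mean of [bregman (f i) x xs] is exactly [F x - min F].  It
    follows that all minimizers share almost surely the same gradients
    ([grad_argmin_unique]), so their common gradient variance is the infimum, and
    that the step inequality becomes, in expectation,
    [E|x_{t+1} - xs|^2 + A E(F x_t - min F) <= E|x_t - xs|^2 + B sigma^2], which
    telescopes.  The comparison with the average iterate is Jensen's inequality.

    Passing to expectations needs [E phi (x_t, i_t) = E Phi (x_t)] with
    [Phi v = E phi (v, i)], for [phi] nonnegative, measurable in [i] and continuous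
    in [x] ([integral_frozen]).  The space may be nonseparable and [x_t] nonmeasurable,
    so this is obtained by approximation.  Replacing the
    gradients by simple vectors in the recursion yields finitely valued sequences
    ([driven]) whose independence of the later indices is proved by induction
    directly from the product rule.  Since the gradients are Lipschitz in [x] and
    Bochner approximable in [i], [x_t] is within any [e > 0] in mean of such a
    sequence ([lipschitz_recursion_approx]), hence is an almost sure limit of them.
    The formula is a finite sum for driven sequences, passes to the limit for
    bounded [phi] by dominated convergence, and then to all [phi >= 0] by
    truncation.  An expectation of a nonnegative function is in general a lower
    integral, which ignores null sets ([ge0_ae_le_integral]); so [x_t] may be
    replaced everywhere by a strongly measurable version [y_t]. *)

Set Implicit Arguments.
Unset Strict Implicit.
Unset Printing Implicit Defensive.

Import Order.TTheory GRing.Theory Num.Theory.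
Import numFieldNormedType.Exports.

Local Open Scope classical_set_scope.
Local Open Scope ring_scope.

(** * Inner products and the Riesz representation *)

Section InnerProduct.
Context {R : realType} {H : hilbertType R}.
Implicit Types (x y z : H) (a : R).

Lemma innerC x y : inner x y = inner y x.
Proof. by rewrite (hermC (inner : {dot H for idfun})) /= expr0 mul1r. Qed.

Lemma innerDr x y z : inner x (y + z) = inner x y + inner x z.
Proof. exact: linearDr. Qed.

Lemma innerNr x y : inner x (- y) = - inner x y.
Proof. exact: linearNr. Qed.

Lemma innerZr a x y : inner x (a *: y) = a * inner x y.
Proof. exact: linearZr_LR. Qed.

Lemma inner0r x : inner x 0 = 0.
Proof. exact: linear0r. Qed.

Lemma innerDl x y z : inner (x + y) z = inner x z + inner y z.
Proof. by rewrite !(innerC _ z) innerDr. Qed.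

Lemma innerNl x y : inner (- x) y = - inner x y.
Proof. by rewrite !(innerC _ y) innerNr. Qed.

Lemma innerZl a x y : inner (a *: x) y = a * inner x y.
Proof. by rewrite !(innerC _ y) innerZr. Qed.

Definition innerE := (innerDr, innerDl, innerNr, innerNl, innerZr, innerZl).

Lemma sqr_normD x y : `|x + y| ^+ 2 = `|x| ^+ 2 + 2 * inner x y + `|y| ^+ 2.
Proof. by rewrite !sqr_norm_inner !innerE (innerC y x); ring. Qed.

Lemma sqr_normB x y : `|x - y| ^+ 2 = `|x| ^+ 2 - 2 * inner x y + `|y| ^+ 2.
Proof. by rewrite sqr_normD normrN innerNr mulrN. Qed.

Lemma inner_le_norm x y : inner x y <= `|x| * `|y|.
Proof.
have [->|x0] := eqVneq x 0; first by rewrite innerC inner0r normr0 mul0r.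
have [->|y0] := eqVneq y 0; first by rewrite inner0r normr0 mulr0.
have xy0 : 0 < `|x| * `|y| by rewrite mulr_gt0 ?normr_gt0.
have := sqr_ge0 `| `|y| *: x - `|x| *: y |.
rewrite sqr_normB !normrZ !normr_id innerZl innerZr => h.
by rewrite -(ler_pM2l xy0); lra.
Qed.

Lemma inner_le_sqr_norm x y : 2 * inner x y <= `|x| ^+ 2 + `|y| ^+ 2.
Proof. by have := sqr_ge0 `|x - y|; rewrite sqr_normB; lra. Qed.

Lemma cvg_inner {T : Type} {F : set_system T} {FF : Filter F} (u v : T -> H) x y :
  u @ F --> x -> v @ F --> y -> (fun t => inner (u t) (v t)) @ F --> inner x y.
Proof.
move=> ux vy.
rewrite (_ : (fun t => _) = fun t => (`|u t + v t| ^+ 2 - `|u t| ^+ 2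
    - `|v t| ^+ 2) / 2); last by apply/funext => t; rewrite sqr_normD; field.
rewrite (_ : inner x y = (`|x + y| ^+ 2 - `|x| ^+ 2 - `|y| ^+ 2) / 2); last first.
  by rewrite sqr_normD; field.
apply: cvgMr_tmp; apply: cvgB; first apply: cvgB.
- by apply: cvgM; apply: cvg_norm; exact: cvgD.
- by apply: cvgM; exact: cvg_norm.
- by apply: cvgM; exact: cvg_norm.
Qed.

(** The first-order condition at a minimum of a quadratic in [t]. *)
Lemma eq0_of_quadratic_ge0 (c q : R) :
  (forall t, 0 <= t * c + t ^+ 2 * q) -> c = 0.
Proof.
move=> cq; apply/eqP/negPn/negP => c0.
have c2 : 0 < c ^+ 2 by rewrite exprn_even_gt0.
have q0 : 0 <= q.
  by have := cq 1; have := cq (-1); rewrite sqrrN expr1n; lra.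
(* any denominator above [q] makes the value negative *)
have := cq (- c / (q + 1)); rewrite leNgt => /negP; apply.
rewrite (_ : _ + _ = - (c ^+ 2 / (q + 1) ^+ 2)); last by field; lra.
by rewrite oppr_lt0 divr_gt0// exprn_gt0; lra.
Qed.

(** Every bounded linear form is an inner product: minimise
    [`|v| ^+ 2 / 2 - l v]; by the parallelogram law minimising sequences are
    Cauchy, and the first-order condition at the limit is the representation. *)
Lemma riesz (l : H -> R) (M : R) :
    (forall x y, l (x + y) = l x + l y) -> (forall a x, l (a *: x) = a * l x) ->
    (forall x, l x <= M * `|x|) ->
  exists v, forall h, l h = inner v h.
Proof.
move=> lD lZ lM; pose J v := `|v| ^+ 2 / 2 - l v; pose m := inf (range J).
have Jlb : has_lbound (range J).
  exists (- (M ^+ 2 / 2)) => _ [v _ <-].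
  by have := lM v; have := sqr_ge0 (`|v| - M); rewrite /J sqrrB; lra.
have mJ v : m <= J v by apply: ge_inf => //; exists v.
have infJ : has_inf (range J) by split => //; exists (J 0), 0.
have /choice[v Jv] (n : nat) : exists v, J v < m + n.+1%:R^-1.
  have n0 : 0 < n.+1%:R^-1 :> R by [].
  by have [_ [w _ <-] ?] := inf_adherent n0 infJ; exists w.
have vv n k : `|v n - v k| ^+ 2 <= 4 * (n.+1%:R^-1 + k.+1%:R^-1).
  have := mJ (2^-1 *: (v n + v k)); rewrite /J lZ lD normrZ gtr0_norm// exprMn.
  rewrite (_ : 2^-1 ^+ 2 = 4^-1 :> R); last by field.
  have := Jv n; have := Jv k; rewrite sqr_normD sqr_normB /J.
  move: n.+1%:R^-1 k.+1%:R^-1 (inner _ _) (l (v n)) (l (v k)) => p q i a b.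
  by lra.
have cv : cvg (v n @[n --> \oo]).
  apply: cauchy_cvg; apply: cauchy_exP => e e0.
  have [N _ Ne] := near_infty_natSinv_lt (PosNum (divr_gt0 (exprn_gt0 2 e0) (ltr0n R 8))).
  exists (v N), N => // n /= Nn.
  rewrite -ball_normE /= -(ltr_pXn2r (n := 2)) ?nnegrE// ?ltW//.
  apply: le_lt_trans (vv _ _) _.
  have := Ne _ Nn; have := Ne _ (leqnn N); rewrite /=.
  by move: n.+1%:R^-1 N.+1%:R^-1 => p q; lra.
pose w := lim (v n @[n --> \oo]).
exists w => h; apply/esym/eqP; rewrite -subr_eq0; apply/eqP.
apply: (@eq0_of_quadratic_ge0 _ (`|h| ^+ 2 / 2)) => t.
have Jt n : - n.+1%:R^-1 <= t * (inner (v n) h - l h) + t ^+ 2 * (`|h| ^+ 2 / 2).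
  have := mJ (v n + t *: h); have := Jv n.
  rewrite /J lD lZ sqr_normD innerZr normrZ exprMn real_normK ?num_real//.
  by move: n.+1%:R^-1 => p; lra.
have vh : t * (inner (v n) h - l h) + t ^+ 2 * (`|h| ^+ 2 / 2) @[n --> \oo] -->
    t * (inner w h - l h) + t ^+ 2 * (`|h| ^+ 2 / 2).
  apply: cvgD; last exact: cvg_cst.
  apply: cvgMl_tmp; apply: cvgB; last exact: cvg_cst.
  by apply: cvg_inner => //; exact: cvg_cst.
have N0 : - n.+1%:R^-1 @[n --> \oo] --> (0 : R).
  by rewrite -oppr0; apply: cvgN; exact: cvg_harmonic.
rewrite -(cvg_lim _ vh)// -(cvg_lim _ N0)//.
apply: ler_lim; [by apply/cvg_ex; exists 0|by apply/cvg_ex; eexists; exact: vh|].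
near=> n; exact: Jt.
Unshelve. all: by end_near. Qed.

End InnerProduct.

(** * Bregman divergences of smooth convex functions *)

Section Gradient.
Context {R : realType} {H : hilbertType R}.
Implicit Types (g : H -> R) (x y v : H) (L : R).

Lemma lipschitzP L (G : H -> H) : L.-lipschitz G ->
  forall x y, `|G x - G y| <= L * `|x - y|.
Proof. by move=> GL x y; exact: (GL (x, y) (conj I I)). Qed.

(** The default value in the definition of [grad] is not reached: the differential is
    a bounded linear form, so [riesz] applies. *)
Lemma diff_grad g x v : differentiable g x -> 'd g x v = inner (grad g x) v.
Proof.
move=> gx; move: v.
suff [w wE] : exists w, forall v, 'd g x v = inner w v.
  exact: (@xgetPex _ 0 [set w | forall v, 'd g x v = inner w v]) (ex_intro _ w wE).
have /linear_boundedP[M [_ Mle]] :=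
  continuous_linear_bounded 0 (@diff_continuous _ _ _ _ _ gx 0).
apply: (@riesz _ _ _ (M + 1)).
- by move=> y z; rewrite linearD.
- by move=> a y; rewrite linearZ.
- by move=> y; apply: le_trans (ler_norm _) _; apply: Mle; rewrite ltrDl.
Qed.

Definition bregman g x y : R := g x - g y - inner (grad g y) (x - y).

(** Convexity bounds the difference quotients of [g] at [y] towards [x] by
    [g x - g y]. *)
Lemma bregman_ge0 g x y :
  convex_function setT g -> differentiable g y -> 0 <= bregman g x y.
Proof.
move=> gconv gy; rewrite /bregman subr_ge0 -diff_grad// -deriveE//.
have := cvg_dnbhs_at_right (diff_derivable (v := x - y) gy).
move=> /cvgr_to_le; apply; near=> t.
have t0 : 0 < t by near: t; exact: nbhs_right_gt.
have t1 : t <= 1 by near: t; exact: nbhs_right_le.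
rewrite /= -ler_pdivlMl ?invr_gt0// invrK mulrC lerBlDr.
have := gconv (Itv01 (ltW t0) t1) x y (mem_set I) (mem_set I).
rewrite convRE /= /conv/= /unstable.onem scalerBr scalerBl scale1r.
rewrite (_ : t *: x - t *: y + y = t *: x + (y - t *: y)) 1?addrAC ?addrA//.
by lra.
Unshelve. all: by end_near. Qed.

Lemma is_derive_line g y v (t : R) : (forall x, differentiable g x) ->
  is_derive t 1 (fun t => g (y + t *: v)) (inner (grad g (y + t *: v)) v).
Proof.
move=> gd.
(* both difference quotients are the same function of the increment *)
have qE : (fun h : R => h^-1 *: (((fun t => g (y + t *: v)) \o shift t) (h *: 1)
      - g (y + t *: v))) =
    (fun h => h^-1 *: ((g \o shift (y + t *: v)) (h *: v) - g (y + t *: v))).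
  apply/funext => h /=; congr (_ *: (g _ - _)).
  by rewrite scalerDl [h *: 1]mulr1 addrCA.
split; first by rewrite /derivable qE; exact: diff_derivable.
by rewrite /derive qE -[RHS]diff_grad// -deriveE.
Qed.

(** The descent lemma: along the segment from [y] to [x] the derivative of
    [t |-> g (y + t (x - y)) - t <grad g y, x - y> - L / 2 * t ^ 2 |x - y| ^ 2]
    is nonpositive by Cauchy-Schwarz and the Lipschitz bound. *)
Lemma bregman_le L g x y :
  smooth L g -> bregman g x y <= L / 2 * `|x - y| ^+ 2.
Proof.
move=> [gd /lipschitzP gL]; pose v := x - y; pose a := inner (grad g y) v.
pose q := L * `|v| ^+ 2.
have slopeE (i b r s : R) :
    i + (- b * 1 + - (r / 2) * (s * 1 + s * 1)) = i - (b + s * r) by field.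
have endE (b r u w : R) : u + (- b * 1 + - (r / 2) * (1 * 1))
    <= w + (- b * 0 + - (r / 2) * (0 * 0)) -> u - w - b <= r / 2 by lra.
have slope (t : R) : 0 <= t -> inner (grad g (y + t *: v)) v <= a + t * q.
  move=> t0; rewrite -lerBlDl -innerNl -innerDl.
  apply: le_trans (inner_le_norm _ _) _.
  have := gL (y + t *: v) y.
  rewrite (_ : y + t *: v - y = t *: v); last by rewrite addrAC subrr add0r.
  rewrite normrZ ger0_norm// => /(ler_wpM2r (normr_ge0 v)) /le_trans; apply.
  by rewrite /q expr2 !mulrA (mulrC L).
pose F : R -> R :=
  (fun t => g (y + t *: v)) + ((- a) \*: id + (- (q / 2)) \*: (id * id)).
have FE t : F t = g (y + t *: v) + (- a * t + - (q / 2) * (t * t)) by [].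
have dF (t : R) : is_derive t 1 F (inner (grad g (y + t *: v)) v - (a + t * q)).
  have d1 := is_derive_line y v t gd.
  have did := is_derive_id t (1 : R).
  have d2 := is_deriveZ (- a) did.
  have d3 := is_deriveZ (- (q / 2)) (is_deriveM did did).
  apply: is_derive_eq (is_deriveD d1 (is_deriveD d2 d3)) _.
  exact: slopeE.
have F10 : F 1 <= F 0.
  apply: (@ler0_derive1_le_cc _ F 0 1); rewrite ?in_itv/= ?lexx ?ler01//.
  - move=> t; rewrite in_itv/= => /andP[t0 t1].
    by rewrite derive1E derive_val subr_le0 slope// ltW.
  - apply: continuous_subspaceT => t.
    by apply/differentiable_continuous/derivable1_diffP.
have yv : y + v = x by rewrite addrC subrK.
move: F10; rewrite !FE scale1r scale0r addr0 yv => /endE.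
by rewrite /bregman -/v -/a /q mulrAC.
Qed.

(** Cocoercivity: compare the lower bound of [bregman_ge0] at [y] with the upper
    bound of [bregman_le] at [x], for the point [x + L^-1 (grad g y - grad g x)]
    where they differ least. *)
Lemma bregman_cocoercive L g x y : 0 < L ->
  convex_function setT g -> smooth L g ->
  `|grad g x - grad g y| ^+ 2 <= 2 * L * bregman g x y.
Proof.
move=> L0 gc gs; rewrite distrC.
(* [i], [j], [p] stand for the inner products of [grad g y], [grad g x] with
   the displacement and of [grad g y] with [x - y] *)
have arith (i j p q gx gy gz : R) : i - j = q ->
    0 <= gz - gy - (L^-1 * i + p) ->
    gz - gx - L^-1 * j <= L / 2 * (L^-1 ^+ 2 * q) ->
    q <= 2 * L * (gx - gy - p).
  move=> <- h1; have -> : L / 2 * (L^-1 ^+ 2 * (i - j)) = L^-1 * (i - j) / 2.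
    by field; lra.
  move=> h2; have h : L^-1 * (i - j) / 2 <= gx - gy - p by lra.
  have -> : i - j = 2 * L * (L^-1 * (i - j) / 2) by field; lra.
  by rewrite ler_pM2l// mulr_gt0.
have [d dE] : exists d, d = grad g y - grad g x by eexists.
rewrite -dE; apply: (arith (inner (grad g y) d) (inner (grad g x) d) _ _ _ _
  (g (x + L^-1 *: d))).
- by rewrite -innerNl -innerDl -dE sqr_norm_inner.
- rewrite -innerZr -innerDr.
  rewrite (_ : L^-1 *: d + (x - y) = (x + L^-1 *: d) - y).
    exact: bregman_ge0 gc (gs.1 y).
  by rewrite addrA (addrC x).
- rewrite -innerZr -exprMn -[L^-1 in leRHS]ger0_norm ?invr_ge0 ?(ltW L0)// -normrZ.
  have xd : x + L^-1 *: d - x = L^-1 *: d by rewrite addrAC subrr add0r.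
  by have := bregman_le (x + L^-1 *: d) x gs; rewrite /bregman xd.
Qed.

(** One step of gradient descent on a single [g].  The cross term is bounded
    through cocoercivity in both directions; for [1 <= gamma * L * (1 + delta)] the
    remaining coefficient of [`|grad g x - grad g y| ^+ 2] is nonnegative, so that
    the square can be traded for [bregman g x y]. *)
Lemma gradient_step L g (gamma delta : R) x y : 0 < L -> 0 < gamma -> 0 < delta ->
  1 <= gamma * L * (1 + delta) ->
  convex_function setT g -> smooth L g ->
  `|x - gamma *: grad g x - y| ^+ 2
    + 2 * gamma * (2 - gamma * L * (1 + delta)) * bregman g x y
    + 2 * gamma * inner (grad g y) (x - y)
  <= `|x - y| ^+ 2 + gamma ^+ 2 * (1 + delta^-1) * `|grad g y| ^+ 2.
Proof.
move=> L0 gamma0 delta0 large gc gs.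
(* Young's inequality, for [nx] the square of a sum *)
have young (V w i nx : R) : nx = V + 2 * i + w ->
    2 * (delta * i) <= delta ^+ 2 * V + w ->
    nx <= (1 + delta) * V + (1 + delta^-1) * w.
  move=> -> h; have : 2 * i <= delta^-1 * (delta ^+ 2 * V + w).
    by rewrite ler_pdivlMl//; lra.
  have -> : delta^-1 * (delta ^+ 2 * V + w) = delta * V + delta^-1 * w.
    by field; lra.
  by lra.
have arith (n nx w V D s p : R) :
    nx <= (1 + delta) * V + (1 + delta^-1) * w ->
    V <= 2 * L * (s - p - D) -> V <= 2 * L * D ->
    n - 2 * (gamma * s) + gamma ^+ 2 * nx
      + 2 * gamma * (2 - gamma * L * (1 + delta)) * D + 2 * gamma * p
    <= n + gamma ^+ 2 * (1 + delta^-1) * w.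
  move=> /(ler_wpM2l (sqr_ge0 gamma)) h0 h1 h2.
  (* [h3] is cocoercivity of [g] from [y] to [x]; [h4] is where [large] is used *)
  have h3 : 0 <= 2 * gamma * (2 * L * (s - p - D) - V) / (2 * L).
    by rewrite divr_ge0 ?mulr_ge0 ?subr_ge0// ltW.
  have h3E : 2 * gamma * (2 * L * (s - p - D) - V) / (2 * L) =
    2 * gamma * (s - p - D) - gamma / L * V by field; lra.
  have h4 : 0 <= gamma / L * (gamma * L * (1 + delta) - 1) * (2 * L * D - V).
    by rewrite !mulr_ge0 ?subr_ge0// ?invr_ge0 ltW.
  have h4E : gamma / L * (gamma * L * (1 + delta) - 1) * (2 * L * D - V) =
    2 * gamma * (gamma * L * (1 + delta) - 1) * D
    - (gamma ^+ 2 * (1 + delta) - gamma / L) * V by field; lra.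
  by rewrite h3E in h3; rewrite h4E in h4; lra.
have stepE : `|x - gamma *: grad g x - y| ^+ 2 = `|x - y| ^+ 2
    - 2 * (gamma * inner (grad g x) (x - y)) + gamma ^+ 2 * `|grad g x| ^+ 2.
  rewrite (addrAC x) (sqr_normB (x - y)) innerZr innerC normrZ exprMn.
  by rewrite real_normK ?num_real.
rewrite stepE; apply: (arith _ _ _ (`|grad g x - grad g y| ^+ 2)).
- apply: (young _ _ (inner (grad g x - grad g y) (grad g y))).
    by rewrite -sqr_normD subrK.
  rewrite -innerZl; apply: le_trans (inner_le_sqr_norm _ _) _.
  by rewrite normrZ exprMn real_normK ?num_real.
- have := bregman_cocoercive y x L0 gc gs; rewrite distrC => /le_trans; apply.
  rewrite /bregman -(opprB x y) innerNr ler_pM2l ?mulr_gt0//.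
  move: (inner _ _) (inner _ _) (g x) (g y) => a b c e; lra.
- exact: bregman_cocoercive.
Qed.

End Gradient.

(** * Integrals up to null sets and independent events *)

Section NonMeasurableIntegral.
Import HBNNSimple.
Local Open Scope ereal_scope.
Context {d : measure_display} {T : measurableType d} {R : realType}
  (mu : {measure set T -> \bar R}).

Lemma ae_null_set (Q : T -> Prop) : (\forall x \ae mu, Q x) ->
  exists N, [/\ measurable N, mu N = 0 & forall x, ~ N x -> Q x].
Proof.
move=> [N [mN N0 QN]]; exists N; split=> // x Nx; apply: contrapT => Qx.
by apply: Nx; apply: QN.
Qed.

(** The integral of a nonnegative function that need not be measurable is its
    lower integral, which is blind to null sets: a simple function below [f] is
    truncated to the complement of the exceptional set. *)
Lemma ge0_ae_le_integral (f g : T -> \bar R) :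
    (forall x, 0 <= f x) -> (forall x, 0 <= g x) ->
    (\forall x \ae mu, f x <= g x) ->
  \int[mu]_x f x <= \int[mu]_x g x.
Proof.
move=> f0 g0 /ae_null_set[N [mN N0 fg]].
rewrite !ge0_integralTE//; apply: ge_ereal_sup => _ [h hf <-].
pose h' := proj_nnsfun h (measurableC mN).
have -> : sintegral mu h = sintegral mu h'.
  rewrite -[RHS]integralT_nnsfun -[LHS]integralT_nnsfun.
  apply: ae_eq_integral => //.
  - exact/measurable_EFinP.
  - exact/measurable_EFinP.
  exists N; split=> // x /= /not_implyP[_ hx]; apply: contrapT => Nx; apply: hx.
  by rewrite mindicE mem_set// mulr1.
apply: ereal_sup_ubound; exists h' => // x.
rewrite /= mindicE; have [/set_mem Nx|Nx] := boolP (x \in ~` N).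
  by rewrite mulr1; exact: le_trans (hf x) (fg _ Nx).
by rewrite mulr0; exact: g0.
Qed.

Lemma ge0_ae_eq_integral (f g : T -> \bar R) :
    (forall x, 0 <= f x) -> (forall x, 0 <= g x) ->
    (\forall x \ae mu, f x = g x) ->
  \int[mu]_x f x = \int[mu]_x g x.
Proof.
move=> f0 g0 fg; apply/eqP; rewrite eq_le; apply/andP; split;
  by apply: ge0_ae_le_integral => //; apply: filterS fg => x ->.
Qed.

End NonMeasurableIntegral.

Section IndependentEvent.
Local Open Scope ereal_scope.
Context {d d' : measure_display} {Omega : measurableType d}
  {I : measurableType d'} {R : realType} (P : probability Omega R)
  (D : probability I R).

(** The restriction of [P] to [A], pushed forward by [X], is a multiple of [D]. *)
Lemma integral_indep_event (A : set Omega) (X : Omega -> I) (f : I -> \bar R) :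
    measurable A -> measurable_fun setT X ->
    (forall B, measurable B -> P (A `&` X @^-1` B) = P A * D B) ->
    measurable_fun setT f -> (forall j, 0 <= f j) ->
  \int[P]_w ((\1_A w)%:E * f (X w)) = P A * \int[D]_j f j.
Proof.
move=> mA mX indep mf f0.
pose g w := f (X w).
have g0 w : 0 <= g w by exact: f0.
have mg : measurable_fun setT g by exact: measurableT_comp.
have ind0 B w : 0 <= (\1_B w)%:E * g w.
  by rewrite mule_ge0// lee_fin.
have mind B : measurable B -> measurable_fun setT (fun w => (\1_B w)%:E * g w).
  move=> mB; apply: emeasurable_funM => //; exact/measurable_EFinP.
(* [P] is the sum of its restrictions to [A] and to the complement of [A] *)
pose Q := mrestr P mA; pose Q' := mrestr P (measurableC mA).
have -> : \int[P]_w ((\1_A w)%:E * g w) =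
    \int[measure_add Q Q']_w ((\1_A w)%:E * g w).
  apply: eq_measure_integral => B mB _.
  transitivity (Q B + Q' B); last exact/esym/measure_addE.
  by rewrite /Q /Q' /= /mrestr -setDE addeC -measureDI.
rewrite ge0_integral_measure_add//; last exact: mind.
have QA' : Q (~` A) = 0 by rewrite /Q /= /mrestr setICl measure0.
have Q'A : Q' A = 0 by rewrite /Q' /= /mrestr setICr measure0.
rewrite [X in _ + X](_ : _ = 0) ?adde0; last first.
  rewrite -[RHS](integral0 Q' setT); apply: ge0_ae_eq_integral => //.
  exists A; split=> // w /= Aw; apply: contrapT => nAw; apply: Aw.
  by rewrite indicE memNset// mul0e.
transitivity (\int[Q]_w g w).
  apply: ge0_ae_eq_integral => //.
  exists (~` A); split=> //; first exact: measurableC.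
  by move=> w /= Aw wA; apply: Aw; rewrite indicE mem_set// mul1e.
transitivity (\int[pushforward Q X]_j f j).
  by rewrite ge0_integral_pushforward// => j _; exact: f0.
have PA : (0 <= fine (P A))%R by rewrite fine_ge0.
rewrite -[P A]fineK ?fin_num_measure// -(@ge0_integral_mscale _ _ _ D _ _ (NngNum PA))//.
apply: eq_measure_integral => B mB _.
transitivity (P (X @^-1` B `&` A)); first by [].
rewrite setIC indep// -[in LHS](fineK (fin_num_measure P _ mA)).
by [].
Qed.

End IndependentEvent.

(** * Simple and strongly measurable vectors *)

Section SimpleVectors.
Context {R : realType} {H : hilbertType R} {d : measure_display}
  {T : measurableType d}.
Implicit Types (s X : T -> H).

Lemma simple_vector_cst (v : H) : simple_vector (fun _ : T => v).
Proof.
split=> [|w].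
  by apply: (@sub_finite_set _ _ [set v]) => [_ [? _ <-]|].
have -> : (fun _ : T => v) @^-1` [set w] = if v == w then setT else set0.
  by case: eqP => [->|vw]; apply/seteqP; split.
by case: ifP.
Qed.

Lemma simple_vector_comp d' (U : measurableType d') (q : U -> H) (Y : T -> U) :
  measurable_fun setT Y -> simple_vector q -> simple_vector (q \o Y).
Proof.
move=> mY [fq mq]; split.
  by apply: sub_finite_set fq => _ [w _ <-]; exists (Y w).
by move=> v; rewrite comp_preimage -[_ @^-1` _]setTI; exact: mY.
Qed.

Lemma simple_vector_bigcup s {U : Type} (phi : H -> T -> U) (B : set U) :
  (fun w => phi (s w) w) @^-1` B =
  \bigcup_(v in range s) (s @^-1` [set v] `&` phi v @^-1` B).
Proof.
apply/seteqP; split=> w /=; first by exists (s w).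
by move=> [v _ [/= <-]].
Qed.

Lemma measurable_simple_vector s d' (U : measurableType d') (phi : H -> T -> U) :
  simple_vector s -> (forall v, measurable_fun setT (phi v)) ->
  measurable_fun setT (fun w => phi (s w) w).
Proof.
move=> [fs ms] mphi _ B mB; rewrite setTI simple_vector_bigcup.
apply: fin_bigcup_measurable => // v _; apply: measurableI => //.
by rewrite -[_ @^-1` _]setTI; exact: mphi.
Qed.

Lemma simple_vector_bind s (q : H -> T -> H) :
  simple_vector s -> (forall v, simple_vector (q v)) ->
  simple_vector (fun w => q (s w) w).
Proof.
move=> [fs ms] sq; split=> [|v].
  apply: (@sub_finite_set _ _ (\bigcup_(u in range s) range (q u))).
    by move=> _ [w _ <-]; exists (s w) => //; exists w.
  by apply: bigcup_finite => // u _; exact: (sq u).1.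
rewrite simple_vector_bigcup; apply: fin_bigcup_measurable => // u _.
by apply: measurableI => //; exact: (sq u).2.
Qed.

Definition strongly_measurable X := exists s : nat -> T -> H,
  (forall n, simple_vector (s n)) /\ (forall w, s n w @[n --> \oo] --> X w).

(** Along the simple vectors that approximate [X], the composition is measurable
    level set by level set. *)
Lemma measurable_caratheodory X (phi : H -> T -> R) :
    strongly_measurable X -> (forall v, measurable_fun setT (phi v)) ->
    (forall w, continuous (phi^~ w)) ->
  measurable_fun setT (fun w => phi (X w) w).
Proof.
move=> [s [ss sX]] mphi cphi.
apply: (measurable_fun_cvg (h := fun n w => phi (s n w) w)) => [n|w _].
  exact: measurable_simple_vector.
exact: (continuous_cvg _ (cphi w (X w)) (sX w)).
Qed.

Lemma strongly_measurable_patch (mu : {measure set T -> \bar R}) X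
    (s : nat -> T -> H) (c : H) :
    (forall n, simple_vector (s n)) ->
    {ae mu, forall w, s n w @[n --> \oo] --> X w} ->
  exists N, [/\ measurable N, mu N = 0%E &
    strongly_measurable (fun w => if w \in N then c else X w)].
Proof.
move=> ss /ae_null_set[N [mN N0 sX]]; exists N; split=> //.
exists (fun n w => if w \in N then c else s n w); split=> [n|w].
  split=> [|v].
    apply: (@sub_finite_set _ _ (c |` range (s n))).
      by move=> _ [v _ <-]; case: ifP => _; [left|right; exists v].
    by rewrite finite_setU; split=> //; exact: (ss n).1.
  have -> : (fun w => if w \in N then c else s n w) @^-1` [set v] =
      (N `&` (fun=> c) @^-1` [set v]) `|` (~` N `&` s n @^-1` [set v]).
    apply/seteqP; split=> w /=.
      by case: ifPn => [/set_mem wN cv|/negP wN sv]; [left|right; split => // /mem_set].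
    by move=> [[/mem_set -> //]|[wN sv]]; rewrite memNset.
  apply: measurableU; apply: measurableI => //.
  - exact: (simple_vector_cst c).2.
  - exact: measurableC.
  - exact: (ss n).2.
by case: ifPn => [_|/negP wN]; [exact: cvg_cst|apply: sX => /mem_set].
Qed.

End SimpleVectors.

(** * Finitely valued recursions driven by an i.i.d. sequence *)

Section Truncation.
Local Open Scope ereal_scope.
Context {d : measure_display} {T : measurableType d} {R : realType}
  (mu : {measure set T -> \bar R}).

Lemma cvg_integral_truncation (f : T -> R) :
    measurable_fun setT f -> (forall x, (0 <= f x)%R) ->
  \int[mu]_x (Num.min (f x) n%:R)%:E @[n --> \oo] --> \int[mu]_x (f x)%:E.
Proof.
move=> mf f0.
have fE : \int[mu]_x (f x)%:E = \int[mu]_x limn (fun n => (Num.min (f x) n%:R)%:E).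
  apply: eq_integral => x _; apply/esym/cvg_lim => //.
  apply: cvg_near_cst; exists (Num.bound (f x)) => // n /= fn.
  congr (_%:E); apply/min_idPl; rewrite (le_trans (ltW (archi_boundP (f0 x))))//.
  by rewrite ler_nat.
rewrite fE; apply: (cvg_monotone_convergence measurableT).
- move=> n; apply/measurable_EFinP; exact: measurable_minr.
- by move=> n x _; rewrite lee_fin le_min f0 ler0n.
- by move=> x _ m n mn; rewrite lee_fin le_min2// ler_nat.
Qed.

End Truncation.

Section DrivenRecursions.
Local Open Scope ereal_scope.
Context {R : realType} {H : hilbertType R} {d d' : measure_display}
  {Omega : measurableType d} {I : measurableType d'} (P : probability Omega R)
  (D : probability I R) (X : nat -> {mfun Omega >-> I}).

(** At time [t] such a sequence depends on the noise before [t] only, and, as [q] is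
    simple in the noise and the state has finitely many values, it stays simple. *)
Inductive driven : nat -> (Omega -> H) -> Prop :=
| driven0 (v : H) : driven 0 (fun=> v)
| drivenS t s (q : H -> I -> H) : driven t s ->
    (forall v, simple_vector (q v)) -> driven t.+1 (fun w => q (s w) (X t w)).

Lemma driven_simple t s : driven t s -> simple_vector s.
Proof.
elim=> [v|{}t {}s q _ ss sq]; first exact: simple_vector_cst.
apply: (@simple_vector_bind _ _ _ _ s (fun v w => q v (X t w))) => // v.
exact: simple_vector_comp.
Qed.

Hypothesis X_iid : iid P D X.

Lemma iid_law t B : measurable B -> P (X t @^-1` B) = D B.
Proof. exact: X_iid.1. Qed.

(** Stating independence for all later times at once makes the induction go
    through: the event at time [t.+1] splits, over the finitely many states at time
    [t], into events with one more constraint on the noise, at time [t]. *)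
Lemma driven_indep_future t s n (A : nat -> set I) (v : H) :
    driven t s -> (t <= n)%N -> (forall k, measurable (A k)) ->
  P (s @^-1` [set v] `&` \bigcap_(k in [set k | (t <= k < n)%N]) X k @^-1` A k)
  = P (s @^-1` [set v]) * \prod_(t <= k < n) D (A k).
Proof.
move=> ds; elim: ds n A v => {t s} [u|t s q ds IH sq] n A v tn mA.
  have capE : P (\bigcap_(k in [set k | (0 <= k < n)%N]) X k @^-1` A k) =
      \prod_(0 <= k < n) D (A k).
    pose J := [fset k in iota 0 n]%fset.
    have JE k : (k \in J) = (k < n)%N by rewrite !inE /= mem_iota.
    have -> : [set k | (0 <= k < n)%N] = [set` J].
      by apply/seteqP; split=> k /=; rewrite JE.
    rewrite (X_iid.2 J A mA).
    have Jn : perm_eq (enum_fset J) (index_iota 0 n).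
      apply: uniq_perm; [exact: fset_uniq|exact: iota_uniq|].
      by move=> k; rewrite mem_index_iota -[LHS]/(k \in J) JE.
    rewrite (perm_big _ Jn) /=.
    by apply: eq_bigr => k _; rewrite iid_law.
  have [uv|uv] := eqVneq u v.
    have -> : (fun _ : Omega => u) @^-1` [set v] = setT.
      by apply/seteqP; split.
    by rewrite setTI probability_setT mul1e capE.
  have -> : (fun _ : Omega => u) @^-1` [set v] = set0.
    by apply/seteqP; split=> // w /= /eqP; rewrite (negbTE uv).
  by rewrite set0I measure0 mul0e.
pose A' u k := if k == t then q u @^-1` [set v] else A k.
have mA' u k : measurable (A' u k).
  by rewrite /A'; case: ifP => // _; exact: (sq u).2.
have fs := (driven_simple ds).1.
have future m : (t < m)%N ->
  P ((fun w => q (s w) (X t w)) @^-1` [set v]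
      `&` \bigcap_(k in [set k | (t < k < m)%N]) X k @^-1` A k) =
  (\sum_(u \in range s) P (s @^-1` [set u]) * D (q u @^-1` [set v]))
    * \prod_(t.+1 <= k < m) D (A k).
  move=> tm; have -> : (fun w => q (s w) (X t w)) @^-1` [set v]
      `&` \bigcap_(k in [set k | (t < k < m)%N]) X k @^-1` A k =
    \bigcup_(u in range s) (s @^-1` [set u]
      `&` \bigcap_(k in [set k | (t <= k < m)%N]) X k @^-1` A' u k).
    apply/seteqP; split=> w /=.
      move=> [qv Xw]; exists (s w) => //; split => // k /= /andP[tk km].
      rewrite /A'; case: ifPn => [/eqP->//|kt]; apply: Xw => /=.
      by rewrite km andbT ltn_neqAle eq_sym kt.
    move=> [u _ [/= <- Xw]]; split.
      by have := Xw t; rewrite /= leqnn tm /A' eqxx; apply.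
    move=> k /= /andP[tk km]; have := Xw k; rewrite /= (ltnW tk) km /A'.
    by rewrite gtn_eqF//; apply.
  rewrite measure_fin_bigcup//; last 2 first.
  - by apply: trivIset_setIr; exact: trivIset_preimage1.
  - move=> u _; apply: measurableI; first exact: (driven_simple ds).2.
    apply: bigcap_measurableType => k _.
    by rewrite -[_ @^-1` _]setTI; exact: measurable_funPT.
  rewrite ge0_mule_fsuml => [|u]; last by rewrite mule_ge0.
  apply: eq_fsbigr => u _.
  etransitivity; first exact: (IH m (A' u) u (ltnW tm) (mA' u)).
  rewrite big_ltn// /A' eqxx muleA; congr (_ * _).
  by apply: eq_big_nat => k /andP[tk _]; rewrite gtn_eqF.
have cap0 : \bigcap_(k in [set k | (t < k < t.+1)%N]) X k @^-1` A k = setT.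
  apply/seteqP; split => // w _ k /= /andP[tk kt].
  by move: kt; rewrite ltnS leqNgt tk.
have := future t.+1 (ltnSn t); rewrite cap0 setIT big_geq// mule1 => ->.
exact: future.
Qed.

Lemma driven_indep t s v B : driven t s -> measurable B ->
  P (s @^-1` [set v] `&` X t @^-1` B) = P (s @^-1` [set v]) * D B.
Proof.
move=> ds mB; have := driven_indep_future v ds (leqnSn t) (fun=> mB).
rewrite big_nat1 => <-; congr (P (_ `&` _)).
apply/seteqP; split => w /=; last by apply; rewrite /= leqnn ltnSn.
move=> Xw k /= /andP[tk kt]; rewrite (_ : k = t)//.
by apply/eqP; rewrite eqn_leq tk -ltnS kt.
Qed.

Lemma integral_driven t s (phi : H -> I -> \bar R) : driven t s ->
    (forall v, measurable_fun setT (phi v)) -> (forall v j, 0 <= phi v j) ->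
  \int[P]_w phi (s w) (X t w) = \int[P]_w \int[D]_j phi (s w) j.
Proof.
move=> ds mphi phi0; have [fs ms] := driven_simple ds.
have levels (psi : H -> Omega -> \bar R) : (forall v w, 0 <= psi v w) ->
    (forall v, measurable_fun setT (psi v)) ->
    \int[P]_w psi (s w) w =
    \sum_(v \in range s) \int[P]_w ((\1_(s @^-1` [set v]) w)%:E * psi v w).
  move=> psi0 mpsi; rewrite -ge0_integral_fsum//; last 2 first.
  - by move=> v; apply: emeasurable_funM => //; exact/measurable_EFinP.
  - by move=> v w _; rewrite mule_ge0// lee_fin.
  apply: eq_integral => w _; rewrite (fsbigD1 (s w))//=; last by exists w.
  rewrite indicE mem_set// mul1e fsbig1 ?adde0// => v [_ /= vs].
  by rewrite indicE memNset ?mul0e// => /= /esym.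
rewrite (levels (fun v w => phi v (X t w)))//; last first.
  by move=> v; exact: measurableT_comp.
rewrite (levels (fun v w => \int[D]_j phi v j))//; last first.
  by move=> v w; exact: integral_ge0.
apply: eq_fsbigr => v _.
rewrite (@integral_indep_event _ _ _ _ _ P D _ (X t))//; last first.
  by move=> B; exact: driven_indep.
under [RHS]eq_integral do rewrite muleC.
rewrite [RHS]ge0_integralZl ?integral_ge0//.
- by rewrite integral_indic// setIT muleC.
- exact/measurable_EFinP.
Qed.

(** Both sides are continuous along almost sure limits, by dominated convergence. *)
Lemma integral_frozen_bounded t x (s : nat -> Omega -> H) (phi : H -> I -> R)
    (M : R) :
    (forall n, driven t (s n)) -> {ae P, forall w, s n w @[n --> \oo] --> x w} ->
    strongly_measurable x ->
    (forall v, measurable_fun setT (phi v)) -> (forall j, continuous (phi^~ j)) ->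
    (forall v j, (0 <= phi v j <= M)%R) ->
  measurable_fun setT (fun w => \int[D]_j (phi (x w) j)%:E) /\
  \int[P]_w (phi (x w) (X t w))%:E = \int[P]_w \int[D]_j (phi (x w) j)%:E.
Proof.
move=> ds sx mx mphi cphi phiM.
have phi0 v j : 0 <= (phi v j)%:E by rewrite lee_fin; case/andP: (phiM v j).
have absM v j : `|(phi v j)%:E| <= M%:E.
  by rewrite gee0_abs// lee_fin; case/andP: (phiM v j).
pose Phi v := \int[D]_j (phi v j)%:E.
have Phi0 v : 0 <= Phi v by exact: integral_ge0.
have mEphi v : measurable_fun setT (fun j => (phi v j)%:E).
  exact/measurable_EFinP.
have intM (d0 : measure_display) (T : measurableType d0) (Q : probability T R) :
    Q.-integrable setT (fun=> M%:E).
  exact: finite_measure_integrable_cst.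
have cPhi (v : nat -> H) u : v n @[n --> \oo] --> u ->
    Phi (v n) @[n --> \oo] --> Phi u.
  move=> vu; have [] // := @dominated_convergence _ _ _ D setT measurableT
    (fun n j => (phi (v n) j)%:E) (fun j => (phi u j)%:E) (fun=> M%:E).
  - apply: aeW => j _; apply: cvg_EFin; first by apply: nearW.
    exact: (continuous_cvg _ (cphi j u) vu).
  - exact: intM.
  - by apply: aeW => j n _; exact: absM.
have PhiM v : `|Phi v| <= M%:E.
  rewrite gee0_abs//; have <- : \int[D]_j M%:E = M%:E.
    rewrite (integral_cst D measurableT M%:E) -[RHS]mule1; congr (_ * _).
    exact: probability_setT.
  apply: ge0_le_integral => // j _.
  by rewrite -(gee0_abs (phi0 v j)).
have mPhi : measurable_fun setT (fun w => Phi (x w)).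
  have [r [sr rx]] := mx.
  apply: (emeasurable_fun_cvg (fun n w => Phi (r n w))) => [n|w _].
    exact: (@measurable_simple_vector _ _ _ _ (r n) _ _ (fun v _ => Phi v)).
  exact: cPhi.
split=> //.
have mx' : measurable_fun setT (fun w => (phi (x w) (X t w))%:E).
  apply/measurable_EFinP.
  apply: (@measurable_caratheodory _ _ _ _ x (fun v w => phi v (X t w))) => // v.
  exact: measurableT_comp.
have [] // := @dominated_convergence _ _ _ P setT measurableT
    (fun n w => (phi (s n w) (X t w))%:E) (fun w => (phi (x w) (X t w))%:E)
    (fun=> M%:E).
- move=> n; apply/measurable_EFinP.
  apply: (@measurable_simple_vector _ _ _ _ (s n) _ _ (fun v w => phi v (X t w))).
    exact: driven_simple.
  by move=> v; exact: measurableT_comp.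
- apply: filterS sx => w sx _; apply: cvg_EFin; first by apply: nearW.
  exact: (continuous_cvg _ (cphi (X t w) (x w)) sx).
- exact: intM.
- by apply: aeW => w n _; exact: absM.
move=> _ _ lhs.
have [] // := @dominated_convergence _ _ _ P setT measurableT
    (fun n w => Phi (s n w)) (fun w => Phi (x w)) (fun=> M%:E).
- move=> n.
  apply: (@measurable_simple_vector _ _ _ _ (s n) _ _ (fun v _ => Phi v)) => //.
  exact: driven_simple.
- by apply: filterS sx => w sx _; exact: cPhi.
- exact: intM.
- by apply: aeW => w n _; exact: PhiM.
move=> _ _ rhs.
rewrite -(cvg_lim _ lhs)// -(cvg_lim _ rhs)//; congr (limn _); apply/funext => n.
exact: (integral_driven (phi := fun v j => (phi v j)%:E)).
Qed.

(** The noise at time [t] is independent of the past, so [x] can be frozen while the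
    noise is averaged. *)
Lemma integral_frozen t x (s : nat -> Omega -> H) (phi : H -> I -> R) :
    (forall n, driven t (s n)) -> {ae P, forall w, s n w @[n --> \oo] --> x w} ->
    strongly_measurable x ->
    (forall v, measurable_fun setT (phi v)) -> (forall j, continuous (phi^~ j)) ->
    (forall v j, (0 <= phi v j)%R) ->
  \int[P]_w (phi (x w) (X t w))%:E = \int[P]_w \int[D]_j (phi (x w) j)%:E.
Proof.
move=> ds sx mx mphi cphi phi0.
pose phin n v j := Num.min (phi v j) n%:R.
have phin0 n v j : (0 <= phin n v j)%R by rewrite le_min phi0 ler0n.
have frozen n := integral_frozen_bounded (phi := phin n) (M := n%:R) ds sx mx.
have {}frozen n : measurable_fun setT (fun w => \int[D]_j (phin n (x w) j)%:E) /\
    \int[P]_w (phin n (x w) (X t w))%:E = \int[P]_w \int[D]_j (phin n (x w) j)%:E.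
  apply: frozen.
  - by move=> v; exact: measurable_minr.
  - move=> j v; apply: (@continuous_min R H (phi^~ j) (fun=> n%:R) v (cphi j v)).
    exact: cvg_cst.
  - by move=> v j; rewrite phin0 ge_min lexx orbT.
have lhs := @cvg_integral_truncation _ _ _ P (fun w => phi (x w) (X t w)).
have {}lhs := lhs _ (fun w => phi0 (x w) (X t w)).
rewrite -(cvg_lim _ (lhs _))//; last first.
  apply: (@measurable_caratheodory _ _ _ _ x (fun v w => phi v (X t w))) => // v.
  exact: measurableT_comp.
under [in LHS]eq_fun do rewrite (frozen _).2.
rewrite -monotone_convergence//.
- by apply: eq_integral => w _; apply: cvg_lim => //; exact: cvg_integral_truncation.
- by move=> n; exact: (frozen n).1.
- by move=> n w _; apply: integral_ge0 => j _; rewrite lee_fin.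
- move=> w _ m n mn; apply: ge0_le_integral => //.
  + by move=> j _; rewrite lee_fin.
  + by apply/measurable_EFinP; exact: measurable_minr.
  + by apply/measurable_EFinP; exact: measurable_minr.
  + by move=> j _; rewrite lee_fin le_min2// ler_nat.
Qed.

End DrivenRecursions.

(** * Approximation in mean *)

Section MeanApproximation.
Local Open Scope ereal_scope.
Context {R : realType} {H : hilbertType R} {d : measure_display}
  {T : measurableType d} (mu : probability T R).

(** [`|X - Y|] need not be measurable, and lower integrals are not subadditive; hence
    the majorant [h]. *)
Definition mean_close (X Y : T -> H) (e : R) := exists h : T -> R,
  [/\ measurable_fun setT h, (forall x, (0 <= h x)%R),
      {ae mu, forall x, (`|X x - Y x| <= h x)%R} & \int[mu]_x (h x)%:E <= e%:E].

(** The approximating sequence of a Bochner expectation, after replacing [X] by a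
    strongly measurable version so that the error itself is a majorant. *)
Lemma has_expectation_approx (X : T -> H) m (e : R) : (0 < e)%R ->
  has_expectation mu X m -> exists2 r, simple_vector r & mean_close X r e.
Proof.
move=> e0 [s [ss sX sE _]].
have [N [mN N0 mX']] := strongly_measurable_patch 0%R ss sX.
set X' := fun w => _ in mX'.
have XX' : {ae mu, forall x, X x = X' x}.
  exists N; split=> // x /= /eqP; rewrite /X'.
  by case: ifPn => [/set_mem//|_]; rewrite eqxx.
have /fine_cvgP[fin_sE /cvgrPdist_lt/(_ e e0) close] := sE.
have [n [finE]] := filter_ex (filterI fin_sE close).
rewrite /= sub0r normrN => /ltW lt_e.
exists (s n) => //; exists (fun x => `|X' x - s n x|)%R; split.
- apply: (@measurable_caratheodory _ _ _ _ X' (fun v x => `|v - s n x|)%R) => //.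
    move=> v; apply: (@measurable_simple_vector _ _ _ _ (s n) _ _
      (fun u _ => `|v - u|)%R) => // u; exact: measurable_cst.
  by move=> w v; apply: cvg_norm; apply: cvgB; [exact: cvg_id|exact: cvg_cst].
- by move=> x; exact: normr_ge0.
- by apply: filterS XX' => x ->.
- rewrite (_ : \int[mu]_x _ = 'E_mu[fun w => `|X w - s n w|%R]).
    by rewrite -(fineK finE) lee_fin (le_trans (ler_norm _)).
  rewrite unlock; apply: ge0_ae_eq_integral => [x|x|].
  + by rewrite lee_fin.
  + by rewrite lee_fin.
  + by apply: filterS XX' => x ->.
Qed.

(** Borel-Cantelli in its integrated form: errors with summable means are almost
    everywhere summable. *)
Lemma mean_close_cvg (X : T -> H) (s : nat -> T -> H) :
  (forall n, mean_close X (s n) (1 / (2 ^ n.+1)%:R)) ->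
  {ae mu, forall x, s n x @[n --> \oo] --> X x}.
Proof.
move=> /choice[h hP].
have mh n : measurable_fun setT (fun x => (h n x)%:E).
  by apply/measurable_EFinP; case: (hP n).
have h0 n x : (0 <= h n x)%R by case: (hP n).
have h0' n x : 0 <= (h n x)%:E by rewrite lee_fin.
have hX : {ae mu, forall x, forall n, (`|X x - s n x| <= h n x)%R}.
  by apply: ae_foralln => n; case: (hP n).
pose S x := \sum_(0 <= n <oo) (h n x)%:E.
have S0 x : 0 <= S x by apply: nneseries_ge0.
have : mu.-integrable setT S.
  apply/integrableP; split; first exact: ge0_emeasurable_sum.
  under eq_integral do rewrite gee0_abs//.
  rewrite integral_nneseries//; apply: (@le_lt_trans _ _ 1%:E); last exact: ltry.
  apply: le_trans (epsilon_trick0 xpredT ler01).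
  by apply: lee_nneseries => n _; [move=> _; apply: integral_ge0|case: (hP n)].
move=> /(integrable_ae measurableT); apply: filterS2 hX => x Xh /(_ Logic.I) finS.
apply/subr_cvg0/norm_cvg0P.
have cvgh : (h n x)%R @[n --> \oo] --> (0 : R)%R.
  apply: cvg_series_cvg_0; apply: nondecreasing_is_cvgn.
    by apply: nondecreasing_series => n _ _.
  exists (fine (S x)) => _ [n _ <-].
  rewrite -lee_fin fineK// /series /= -sumEFin; exact: nneseries_lim_ge.
apply: (@squeeze_cvgr _ _ _ _ (fun=> 0%R) (fun n => h n x)) => //.
  by apply: nearW => n; rewrite normr_ge0 distrC Xh.
exact: cvg_cst.
Qed.

End MeanApproximation.

(** * Lipschitz recursions *)

Section LipschitzRecursion.
Local Open Scope ereal_scope.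
Context {R : realType} {H : hilbertType R} {d d' : measure_display}
  {Omega : measurableType d} {I : measurableType d'} (P : probability Omega R)
  (D : probability I R) (X : nat -> {mfun Omega >-> I}).
Hypothesis X_iid : iid P D X.

Lemma iid_ae t (Q : I -> Prop) :
  {ae D, forall j, Q j} -> {ae P, forall w, Q (X t w)}.
Proof.
move=> [N [mN N0 QN]]; exists (X t @^-1` N); split.
- by rewrite -[_ @^-1` _]setTI; exact: measurable_funPT.
- by rewrite (iid_law X_iid).
- by move=> w Qw; exact: QN.
Qed.

Lemma iid_integral t (f : I -> \bar R) : measurable_fun setT f ->
  (forall j, 0 <= f j) -> \int[P]_w f (X t w) = \int[D]_j f j.
Proof.
move=> mf f0; rewrite -(ge0_integral_distribution (X t) mf f0).
by apply: eq_measure_integral => B mB _; exact: X_iid.1.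
Qed.

Context (G : H -> I -> H) (K : R) (v0 : H) (z : nat -> Omega -> H).
Hypotheses (K0 : (0 <= K)%R)
  (G_lip : forall u v j, (`|G u j - G v j| <= K * `|u - v|)%R)
  (G_approx : forall v e, (0 < e)%R ->
     exists2 r, simple_vector r & mean_close D (G v) r e)
  (z0 : forall w, z 0 w = v0) (zS : forall t w, z t.+1 w = G (z t w) (X t w)).

(** The error obeys [err_{t+1} <= K * err_t + noise error].  The noise error depends
    on the state of [s], but is at most the sum of the errors over its finitely many
    values, and each of these has a mean given by the law of the noise. *)
Lemma lipschitz_recursion_approx t (e : R) : (0 < e)%R ->
  exists2 s, driven X t s & mean_close P (z t) s e.
Proof.
elim: t e => [|t IH] e e0.
  exists (fun=> v0); first exact: driven0.
  exists (fun=> 0%R); split=> //; last by rewrite integral0 lee_fin ltW.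
  by apply: aeW => w; rewrite z0 subrr normr0.
have K1 : (0 < K + 1)%R by rewrite ltr_wpDl.
have [s ds [h [mh h0 zs inth]]] := IH _ (divr_gt0 (divr_gt0 e0 (ltr0n R 2)) K1).
(* the budget [e / 2] is shared by the values of [s]; the successor avoids a
   division by zero *)
pose L := fset_set (range s); pose m := (size L).+1.
have e2 : (0 < e / 2 / m%:R)%R by rewrite !divr_gt0.
have rg u : exists rg : (I -> H) * (I -> R), [/\ simple_vector rg.1,
    measurable_fun setT rg.2, (forall j, 0 <= rg.2 j)%R,
    {ae D, forall j, (`|G u j - rg.1 j| <= rg.2 j)%R} &
    \int[D]_j (rg.2 j)%:E <= (e / 2 / m%:R)%:E].
  by have [r sr [g [mg g0 ug intg]]] := G_approx u e2; exists (r, g).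
move: rg => /choice[rg rgP].
have fs := (driven_simple ds).1.
exists (fun w => (rg (s w)).1 (X t w)).
  by apply: (drivenS (q := fun u => (rg u).1)) => // u; case: (rgP u).
pose S w := (\sum_(u <- L) (rg u).2 (X t w))%R.
have rg0 u j : (0 <= (rg u).2 j)%R by case: (rgP u).
have mrg u : measurable_fun setT (fun w => (rg u).2 (X t w)).
  by apply: measurableT_comp => //; case: (rgP u).
exists (fun w => K * h w + S w)%R; split.
- apply: measurable_funD; first exact: measurable_funM.
  exact: measurable_sum.
- by move=> w; rewrite addr_ge0 ?mulr_ge0 ?sumr_ge0.
- have : {ae P, forall w, (\bigcap_(u in [set` L])
      [set w | `|G u (X t w) - (rg u).1 (X t w)| <= (rg u).2 (X t w)]%R) w}.
    apply: filter_bigI => u _; apply: (iid_ae t (Q := fun j =>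
      (`|G u j - (rg u).1 j| <= (rg u).2 j)%R)).
    by case: (rgP u).
  apply: filterS2 zs => w zsw Lw.
  have sL : s w \in L by rewrite in_fset_set// mem_set//; exists w.
  rewrite zS -(subrK (G (s w) (X t w)) (G (z t w) _)) -addrA.
  rewrite (le_trans (ler_normD _ _))// lerD//.
    by rewrite (le_trans (G_lip _ _ _))// ler_wpM2l.
  rewrite (le_trans (Lw (s w) sL))// /S (big_rem (s w))//= lerDl.
  by rewrite sumr_ge0.
- rewrite /S; under eq_integral => w _ do rewrite EFinD EFinM -sumEFin.
  rewrite ge0_integralD//; last 4 first.
  + by move=> w _; rewrite mule_ge0// lee_fin.
  + by apply: emeasurable_funM => //; exact/measurable_EFinP.
  + by move=> w _; apply: sume_ge0 => u _; rewrite lee_fin.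
  + by apply: emeasurable_sum => u; exact/measurable_EFinP.
  rewrite ge0_integralZl//; last 2 first.
  + exact/measurable_EFinP.
  + by move=> w _; rewrite lee_fin.
  rewrite ge0_integral_sum//; last 2 first.
  + by move=> u; exact/measurable_EFinP.
  + by move=> u w _; rewrite lee_fin.
  rewrite [e in leRHS]splitr EFinD; apply: leeD.
    apply: (@le_trans _ _ (K%:E * (e / 2 / (K + 1))%:E)).
      by apply: lee_wpmul2l => //; rewrite lee_fin.
    by rewrite -EFinM lee_fin mulrA ler_pdivrMr// mulrC ler_pM2l ?divr_gt0// lerDl.
  apply: (@le_trans _ _ (\sum_(u <- L) (e / 2 / m%:R)%:E)).
    apply: lee_sum => u _.
    rewrite (iid_integral t (f := fun j => ((rg u).2 j)%:E)) => [|//|j].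
    + by case: (rgP u).
    + by apply/measurable_EFinP; case: (rgP u).
    + by rewrite lee_fin.
  rewrite sumEFin lee_fin big_const_seq count_predT iter_addr_0 -(mulr_natr (_ / m%:R)).
  by rewrite [leLHS]mulrAC ler_pdivrMr// ler_pM2l ?divr_gt0// ler_nat.
Qed.

Lemma lipschitz_recursion_cvg t : exists2 s : nat -> Omega -> H,
  (forall n, driven X t (s n)) & {ae P, forall w, s n w @[n --> \oo] --> z t w}.
Proof.
have /choice[s sP] (n : nat) : exists s, driven X t s /\
    mean_close P (z t) s (1 / (2 ^ n.+1)%:R).
  have e0 : (0 < 1 / (2 ^ n.+1)%:R :> R)%R by rewrite divr_gt0// ltr0n expn_gt0.
  by have [s ds sz] := lipschitz_recursion_approx t e0; exists s.
exists s => [n|]; first by case: (sP n).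
by apply: mean_close_cvg => n; case: (sP n).
Qed.

End LipschitzRecursion.

(** * The random objective *)

Section RandomObjective.
Context {R : realType} {H : hilbertType R} {d : measure_display}
  {I : measurableType d} (D : probability I R) (f : I -> H -> R) (L : R).
Hypotheses (L0 : 0 < L)
  (f_int : forall x, D.-integrable setT (fun j => (f j x)%:E))
  (f_convex : forall j, convex_function setT (f j))
  (f_smooth : forall j, smooth L (f j)).

Let f_diff j x : differentiable (f j) x := (f_smooth j).1 x.

Lemma objectiveE x : objective D f x = \int[D]_j f j x.
Proof. by rewrite /objective unlock. Qed.

Lemma measurable_f x : measurable_fun setT (f^~ x).
Proof. exact/measurable_EFinP/(measurable_int D)/f_int. Qed.

(** The directional derivatives are limits of difference quotients, at the rate
    that smoothness gives. *)
Lemma measurable_inner_grad x h :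
  measurable_fun setT (fun j => inner (grad (f j) x) h).
Proof.
pose q n j := n.+1%:R * (f j (x + n.+1%:R^-1 *: h) - f j x).
apply: (measurable_fun_cvg (h := q)) => [n|j _].
  apply: measurable_funM; first exact: measurable_cst.
  by apply: measurable_funB; exact: measurable_f.
have quot n : q n j - inner (grad (f j) x) h =
    n.+1%:R * bregman (f j) (x + n.+1%:R^-1 *: h) x.
  rewrite /q /bregman (_ : x + n.+1%:R^-1 *: h - x = n.+1%:R^-1 *: h).
    by rewrite innerZr [RHS]mulrBr (mulrA n.+1%:R) divff ?pnatr_eq0// mul1r.
  by rewrite addrAC subrr add0r.
apply/subr_cvg0; apply: (@squeeze_cvgr _ _ _ _ (fun=> 0)
    (fun n => n.+1%:R^-1 * (L / 2 * `|h| ^+ 2))).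
- apply: nearW => n; rewrite quot mulr_ge0 ?bregman_ge0//=.
  rewrite -ler_pdivlMl// mulrA -invfM -expr2.
  apply: le_trans (bregman_le _ _ (f_smooth j)) _.
  rewrite (_ : x + n.+1%:R^-1 *: h - x = n.+1%:R^-1 *: h); last first.
    by rewrite addrAC subrr add0r.
  by rewrite normrZ exprMn real_normK ?num_real// exprVn mulrCA.
- exact: cvg_cst.
- rewrite -[X in _ --> X](mul0r (L / 2 * `|h| ^+ 2)).
  by apply: cvgM; [exact: cvg_harmonic|exact: cvg_cst].
Qed.

Lemma inner_grad_bounds j x h :
  f j (x + h) - f j x - L / 2 * `|h| ^+ 2 <= inner (grad (f j) x) h
  <= f j (x + h) - f j x.
Proof.
have := bregman_ge0 (x + h) (f_convex j) (f_diff j x).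
have := bregman_le (x + h) x (f_smooth j).
rewrite /bregman (_ : x + h - x = h); last by rewrite addrAC subrr add0r.
by move: (inner _ _) => p h1 h2; apply/andP; split; lra.
Qed.

Lemma integrable_inner_grad x h :
  D.-integrable setT (EFin \o (fun j => inner (grad (f j) x) h)).
Proof.
pose g j := `|f j (x + h)| + `|f j x| + L / 2 * `|h| ^+ 2.
apply: (@le_integrable _ _ _ _ _ measurableT _ (EFin \o g)).
- exact/measurable_EFinP/measurable_inner_grad.
- move=> j _ /=; rewrite lee_fin [leRHS]ger0_norm; last first.
    by rewrite !addr_ge0// mulr_ge0 ?exprn_ge0// divr_ge0// ltW.
  have /andP[h1 h2] := inner_grad_bounds j x h.
  have := ler_norm (f j (x + h)); have := ler_norm (f j x).
  have := ler_norm (- f j (x + h)); have := ler_norm (- f j x); rewrite !normrN.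
  have q0 : 0 <= L / 2 * `|h| ^+ 2 by rewrite mulr_ge0 ?exprn_ge0// divr_ge0// ltW.
  rewrite ler_norml /g; move: h1 h2 q0; move: (inner _ _) (L / 2 * _) => p q.
  by move=> *; apply/andP; split; lra.
- apply: (@integrableD _ _ _ _ _ measurableT
    (EFin \o fun j => `|f j (x + h)| + `|f j x|) (EFin \o cst (L / 2 * `|h| ^+ 2))).
    apply: (@integrableD _ _ _ _ _ measurableT
      (EFin \o fun j => `|f j (x + h)|) (EFin \o fun j => `|f j x|)).
      exact: (integrable_abse (f_int (x + h))).
    exact: (integrable_abse (f_int x)).
  exact: finite_measure_integrable_cst.
Qed.

Lemma measurable_bregman x y : measurable_fun setT (fun j => bregman (f j) x y).
Proof.
apply: measurable_funB; last exact: measurable_inner_grad.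
by apply: measurable_funB; exact: measurable_f.
Qed.

Lemma Rintegral_bregman x y :
  D.-integrable setT (EFin \o fun j => bregman (f j) x y) /\
  \int[D]_j bregman (f j) x y
  = objective D f x - objective D f y - \int[D]_j inner (grad (f j) y) (x - y).
Proof.
have fB : D.-integrable setT (EFin \o fun j => f j x - f j y).
  exact: (integrableB measurableT (f_int x) (f_int y)).
split.
  exact: (integrableB measurableT fB (integrable_inner_grad y (x - y))).
rewrite !objectiveE RintegralB ?RintegralB//.
- exact: f_int.
- exact: f_int.
- exact: integrable_inner_grad.
Qed.

(** Jensen's inequality for the objective: sum the supporting hyperplanes at the
    average, whose linear parts cancel. *)
Lemma objective_average (u : nat -> H) (T : nat) : (0 < T)%N ->
  objective D f (T%:R^-1 *: \sum_(t < T) u t)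
  <= T%:R^-1 * \sum_(t < T) objective D f (u t).
Proof.
move=> T0; set v := _ *: _; pose l h := \int[D]_j inner (grad (f j) v) h.
have lD : {morph l : h k / h + k}.
  move=> h k; rewrite /l -RintegralD//; try exact: integrable_inner_grad.
  by apply: eq_Rintegral => j _; rewrite innerDr.
have l0 : l 0 = 0.
  rewrite /l; under eq_Rintegral do rewrite inner0r.
  by rewrite Rintegral_cst// mul0r.
have hyperplane t : objective D f v + l (u t - v) <= objective D f (u t).
  have [_ /esym ibE] := Rintegral_bregman (u t) v.
  have : 0 <= \int[D]_j bregman (f j) (u t) v.
    by apply: Rintegral_ge0 => j _; exact: bregman_ge0.
  by rewrite -ibE -/(l _); lra.
rewrite ler_pdivlMl ?ltr0n//.
apply: le_trans (ler_sum _ (fun (t : 'I_T) _ => hyperplane t)).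
rewrite big_split /= sumr_const card_ord -(big_morph l lD l0) sumrB sumr_const card_ord.
rewrite -[v *+ T]scaler_nat /v scalerA divff ?pnatr_eq0 -?lt0n// scale1r subrr l0 addr0.
by rewrite mulr_natl.
Qed.

Variables (xs : H) (xs_min : argmin (objective D f) xs).

(** First-order optimality in the mean, by integrating the descent lemma: the
    map [t |-> t E<grad f_j xs, h> + t ^ 2 L |h| ^ 2 / 2] is nonnegative. *)
Lemma Rintegral_inner_grad_argmin h : \int[D]_j inner (grad (f j) xs) h = 0.
Proof.
apply: (@eq0_of_quadratic_ge0 _ _ (L / 2 * `|h| ^+ 2)) => t.
have [ib ibE] := Rintegral_bregman (xs + t *: h) xs.
have : \int[D]_j bregman (f j) (xs + t *: h) xs <= t ^+ 2 * (L / 2 * `|h| ^+ 2).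
  have -> : t ^+ 2 * (L / 2 * `|h| ^+ 2) = \int[D]_j (t ^+ 2 * (L / 2 * `|h| ^+ 2)).
    rewrite Rintegral_cst// -[LHS]mulr1; congr (_ * _).
    by rewrite -[1]/(fine 1%E); congr fine; exact/esym/probability_setT.
  apply: le_Rintegral => //.
    exact: finite_measure_integrable_cst.
  move=> j _; apply: le_trans (bregman_le _ _ (f_smooth j)) _.
  rewrite (_ : xs + t *: h - xs = t *: h); last by rewrite addrAC subrr add0r.
  by rewrite normrZ exprMn real_normK ?num_real// mulrCA.
rewrite ibE (_ : xs + t *: h - xs = t *: h); last by rewrite addrAC subrr add0r.
under eq_Rintegral do rewrite innerZr.
rewrite RintegralZl//; last exact: integrable_inner_grad.
by have := xs_min (xs + t *: h); lra.
Qed.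

Definition gap x : R := objective D f x - objective D f xs.

Lemma gap_ge0 x : 0 <= gap x.
Proof. by rewrite subr_ge0. Qed.

Lemma minimum_argmin : minimum (objective D f) = objective D f xs.
Proof.
apply/le_anti/andP; split.
  by apply: ge_inf; [exists (objective D f xs) => _ [y _ <-]|exists xs].
by apply: lb_le_inf; [exists (objective D f xs), xs|move=> _ [y _ <-]].
Qed.

Lemma integral_bregman_gap x :
  (\int[D]_j (bregman (f j) x xs)%:E = (gap x)%:E)%E.
Proof.
have [ib ibE] := Rintegral_bregman x xs.
rewrite -[LHS]fineK; last exact: integrable_fin_num.
by congr (_%:E); rewrite -/(Rintegral _ _ _) ibE Rintegral_inner_grad_argmin subr0.
Qed.

(** Two minimizers have almost surely the same stochastic gradients, since the mean
    Bregman divergence between them vanishes. *)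
Lemma grad_argmin_unique y : argmin (objective D f) y ->
  {ae D, forall j, grad (f j) y = grad (f j) xs}.
Proof.
move=> y_min; have gap0 : gap y = 0.
  by apply/le_anti; rewrite gap_ge0 subr_le0 y_min.
have mb := measurable_bregman y xs.
have b0 j : 0 <= bregman (f j) y xs by exact: bregman_ge0.
have : (\int[D]_j `|(bregman (f j) y xs)%:E| = 0)%E.
  under eq_integral do rewrite gee0_abs ?lee_fin//.
  by rewrite integral_bregman_gap gap0.
move/ae_eq_integral_abs => /(_ measurableT).
move=> /(_ (proj2 (measurable_EFinP _ _) mb)); apply: filterS => j /(_ Logic.I) [bj].
have := bregman_cocoercive y xs L0 (f_convex j) (f_smooth j).
rewrite bj mulr0 => V0; apply/eqP.
by rewrite -subr_eq0 -normr_eq0 -sqrf_eq0; apply/eqP/le_anti; rewrite V0 sqr_ge0.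
Qed.

Lemma grad_variance_argmin :
  (\int[D]_j (`|grad (f j) xs| ^+ 2)%:E <= solution_grad_variance D f)%E.
Proof.
apply/ereal_infP => _ [y y_min <-]; rewrite unlock.
apply: ge0_ae_le_integral => [j|j|].
- by rewrite lee_fin sqr_ge0.
- by rewrite lee_fin sqr_ge0.
- by apply: filterS (grad_argmin_unique y_min) => j ->.
Qed.

End RandomObjective.

(** * The stochastic gradient iteration *)

Section SGDProcess.
Context {R : realType} {H : hilbertType R} {dI dO : measure_display}
  {I : measurableType dI} {Omega : measurableType dO} (D : probability I R)
  (P : probability Omega R) (f : I -> H -> R) (L gamma : R) (x0 xs : H)
  (X : nat -> {mfun Omega >-> I}).
Hypotheses (L0 : 0 < L) (gamma0 : 0 < gamma)
  (f_int : forall x, D.-integrable setT (fun j => (f j x)%:E))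
  (f_convex : forall j, convex_function setT (f j))
  (f_smooth : forall j, smooth L (f j))
  (F_diff : forall x, differentiable (objective D f) x)
  (grad_int : forall x, exists m, has_expectation D (fun j => grad (f j) x) m)
  (xs_min : argmin (objective D f) xs)
  (X_iid : iid P D X).

Let x := sgd f gamma x0 X.
Let gapF := gap D f xs.
Let V : \bar R := (\int[D]_j (`|grad (f j) xs| ^+ 2)%:E)%E.

(** The recursion is Lipschitz with constant [1 + gamma * L]; on the null set where the
    approximations fail, the iterate is replaced by [xs]. *)
Lemma sgd_version t : exists y : Omega -> H,
  [/\ exists2 s, (forall n, driven X t (s n)) &
        {ae P, forall w, s n w @[n --> \oo] --> y w},
      strongly_measurable y & {ae P, forall w, y w = x t w}].
Proof.
have grad_lip u v j : `|u - gamma *: grad (f j) u - (v - gamma *: grad (f j) v)|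
    <= (1 + gamma * L) * `|u - v|.
  have -> : u - gamma *: grad (f j) u - (v - gamma *: grad (f j) v) =
      u - v - gamma *: (grad (f j) u - grad (f j) v).
    by rewrite scalerBr !opprB [_ *: _ - v]addrC addrACA [- _ + _ *: _]addrC.
  rewrite (le_trans (ler_normB _ _))// mulrDl mul1r lerD2l normrZ gtr0_norm//.
  by rewrite -mulrA ler_pM2l// (lipschitzP (f_smooth j).2).
have approx v e : 0 < e -> exists2 r, simple_vector r &
    mean_close D (fun j => v - gamma *: grad (f j) v) r e.
  move=> e0; have [m vm] := grad_int v.
  have [r sr [h [mh h0 rh inth]]] := has_expectation_approx (divr_gt0 e0 gamma0) vm.
  exists (fun j => v - gamma *: r j).
    apply: (@simple_vector_bind _ _ _ _ r (fun u _ => v - gamma *: u)) => // u.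
    exact: simple_vector_cst.
  exists (fun j => gamma * h j); split.
  - exact: measurable_funM.
  - by move=> j; rewrite mulr_ge0// ltW.
  - apply: filterS rh => j rh.
    rewrite opprB addrC addrA subrK -scalerBr normrZ gtr0_norm// ler_pM2l//.
    by rewrite distrC.
  - under eq_integral do rewrite EFinM.
    rewrite ge0_integralZl ?lee_fin ?(ltW gamma0)//.
    + have -> : (e%:E = gamma%:E * (e / gamma)%:E)%E.
        by rewrite -EFinM mulrC divfK// gt_eqF.
      by apply: lee_wpmul2l => //; rewrite lee_fin ltW.
    + exact/measurable_EFinP.
    + by move=> j _; rewrite lee_fin.
have K0 : 0 <= 1 + gamma * L by rewrite addr_ge0// mulr_ge0// ltW.
have [s ds sx] := @lipschitz_recursion_cvg _ _ _ _ _ _ P D X X_iid _ _ x0 x K0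
  (fun u v j => grad_lip u v j) approx (fun=> erefl) (fun t w => erefl) t.
have [N [mN N0 my]] := strongly_measurable_patch xs (fun n => driven_simple (ds n)) sx.
set y := (fun w => _) in my; exists y.
have yx : {ae P, forall w, y w = x t w}.
  exists N; split=> // w /= yw; apply: contrapT => Nw; apply: yw.
  by rewrite /y memNset.
split=> //; exists s => //.
by apply: filterS2 sx yx => w + ->.
Qed.

(** Positive and negative parts of the linear term of the step, since
    [integral_frozen] averages nonnegative functions. *)
Let ipos v j := Num.max (inner (grad (f j) xs) (v - xs)) 0.
Let ineg v j := Num.max (- inner (grad (f j) xs) (v - xs)) 0.

Let ipos_sub_ineg v j : ipos v j - ineg v j = inner (grad (f j) xs) (v - xs).
Proof.
rewrite /ipos /ineg; move: (inner _ _) => a.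
by have [a0|a0] := leP 0 a; [rewrite (max_r (y := 0))|rewrite (max_l (y := 0))]; lra.
Qed.

Let ipos_ge0 v j : 0 <= ipos v j. Proof. by rewrite le_max lexx orbT. Qed.
Let ineg_ge0 v j : 0 <= ineg v j. Proof. by rewrite le_max lexx orbT. Qed.

Let measurable_inner v :
  measurable_fun setT (fun j => inner (grad (f j) xs) (v - xs)).
Proof. exact: measurable_inner_grad. Qed.

Let measurable_ipos v : measurable_fun setT (ipos v).
Proof. exact: measurable_maxr. Qed.

Let measurable_ineg v : measurable_fun setT (ineg v).
Proof. by apply: measurable_maxr => //; exact: measurable_funN. Qed.

Let continuous_inner j : continuous (fun v => inner (grad (f j) xs) (v - xs)).
Proof.
move=> v; apply: cvg_inner; first exact: cvg_cst.
by apply: cvgB; [exact: cvg_id|exact: cvg_cst].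
Qed.

Let continuous_ipos j : continuous (ipos^~ j).
Proof.
move=> v; apply: (@continuous_max R H _ (fun=> 0) v); last exact: cvg_cst.
exact: continuous_inner.
Qed.

Let continuous_ineg j : continuous (ineg^~ j).
Proof.
move=> v; apply: (@continuous_max R H (fun v => - inner (grad (f j) xs) (v - xs))
  (fun=> 0) v); last exact: cvg_cst.
by apply: cvgN; exact: continuous_inner.
Qed.

(** Their difference has mean zero, as [xs] is a minimizer. *)
Let integral_ipos_ineg v : (\int[D]_j (ipos v j)%:E = \int[D]_j (ineg v j)%:E)%E.
Proof.
have ii := integrable_inner_grad L0 f_int f_convex f_smooth xs (v - xs).
have ip : D.-integrable setT (EFin \o ipos v).
  apply: (le_integrable measurableT _ _ ii); first exact/measurable_EFinP.
  move=> j _ /=; rewrite lee_fin ger0_norm// ge_max ler_norm normr_ge0//.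
have mE j : ineg v j = ipos v j - inner (grad (f j) xs) (v - xs).
  by rewrite -ipos_sub_ineg subKr.
have im : D.-integrable setT (EFin \o ineg v).
  rewrite (_ : ineg v = fun j => ipos v j - inner (grad (f j) xs) (v - xs)).
    exact: (integrableB measurableT ip ii).
  exact/funext.
rewrite -[LHS]fineK; last exact: integrable_fin_num.
rewrite -[RHS]fineK; last exact: integrable_fin_num.
congr (_%:E); apply/esym.
transitivity (\int[D]_j (ipos v j - inner (grad (f j) xs) (v - xs))).
  by apply: eq_Rintegral => j _; exact: mE.
rewrite RintegralB// (Rintegral_inner_grad_argmin L0 f_int f_convex f_smooth xs_min).
by rewrite subr0.
Qed.

Let div v j := bregman (f j) v xs.

Let div_ge0 v j : 0 <= div v j.
Proof. exact: bregman_ge0 (f_convex j) ((f_smooth j).1 xs). Qed.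

Let measurable_div v : measurable_fun setT (div v).
Proof. exact: measurable_bregman. Qed.

Let continuous_div j : continuous (div^~ j).
Proof.
move=> v; apply: cvgB; last exact: continuous_inner.
apply: cvgB; last exact: cvg_cst.
exact: differentiable_continuous ((f_smooth j).1 v).
Qed.

(** [grad (f j) xs] is almost surely a limit of simple vectors, hence has a version
    whose norm is measurable. *)
Lemma measurable_sqr_grad : exists g2 : I -> R, [/\ measurable_fun setT g2,
  forall j, 0 <= g2 j & {ae D, forall j, g2 j = `|grad (f j) xs| ^+ 2}].
Proof.
have [u [s [ss sg _ _]]] := grad_int xs.
have [N [mN N0 mg]] := strongly_measurable_patch 0 ss sg.
exists (fun j => `|if j \in N then 0 else grad (f j) xs| ^+ 2); split.
- apply: (@measurable_caratheodory _ _ _ _ _ (fun v _ => `|v| ^+ 2) mg) => //.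
  by move=> _ v; apply: cvgM; apply: cvg_norm; exact: cvg_id.
- by move=> j; rewrite sqr_ge0.
- exists N; split=> // j /= gj; apply: contrapT => Nj; apply: gj.
  by rewrite memNset.
Qed.

Variables (delta : R).
Hypotheses (delta0 : 0 < delta) (large : 1 <= gamma * L * (1 + delta))
  (small : gamma * L * (1 + delta) <= 2).
Let A := 2 * gamma * (2 - gamma * L * (1 + delta)).
Let B := gamma ^+ 2 * (1 + delta^-1).

Let A0 : 0 <= A. Proof. by rewrite mulr_ge0 ?subr_ge0// mulr_ge0// ltW. Qed.
Let B0 : 0 <= B.
Proof. by rewrite mulr_ge0 ?sqr_ge0// addr_ge0// invr_ge0 ltW. Qed.

Variable (y : nat -> Omega -> H).
Hypothesis yP : forall t,
  [/\ exists2 s, (forall n, driven X t (s n)) &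
        {ae P, forall w, s n w @[n --> \oo] --> y t w},
      strongly_measurable (y t) & {ae P, forall w, y t w = x t w}].

Local Open Scope ereal_scope.

Let frozen t (phi : H -> I -> R) : (forall v, measurable_fun setT (phi v)) ->
    (forall j, continuous (phi^~ j)) -> (forall v j, (0 <= phi v j)%R) ->
  \int[P]_w (phi (y t w) (X t w))%:E = \int[P]_w \int[D]_j (phi (y t w) j)%:E.
Proof.
move=> mphi cphi phi0; have [[s ds sy] my _] := yP t.
exact: (integral_frozen X_iid ds sy my).
Qed.

Let measurable_at t (phi : H -> I -> R) : (forall v, measurable_fun setT (phi v)) ->
    (forall j, continuous (phi^~ j)) ->
  measurable_fun setT (fun w => phi (y t w) (X t w)).
Proof.
move=> mphi cphi; have [_ my _] := yP t.
apply: (@measurable_caratheodory _ _ _ _ (y t) (fun v w => phi v (X t w))) => // v.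
exact: measurableT_comp.
Qed.

Let integral_comb (u1 u2 u3 : Omega -> R) (k l : R) :
    measurable_fun setT u1 -> measurable_fun setT u2 -> measurable_fun setT u3 ->
    (forall w, 0 <= u1 w)%R -> (forall w, 0 <= u2 w)%R -> (forall w, 0 <= u3 w)%R ->
    (0 <= k)%R -> (0 <= l)%R ->
  \int[P]_w (u1 w + (k * u2 w + l * u3 w))%:E = \int[P]_w (u1 w)%:E
    + (k%:E * \int[P]_w (u2 w)%:E + l%:E * \int[P]_w (u3 w)%:E).
Proof.
move=> mu1 mu2 mu3 u10 u20 u30 k0 l0.
rewrite (eq_integral (fun w => (u1 w)%:E + (k%:E * (u2 w)%:E + l%:E * (u3 w)%:E)));
  last by move=> w _; rewrite !EFinD !EFinM.
have mZ (c : R) (u : Omega -> R) : measurable_fun setT u ->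
    measurable_fun setT (fun w => c%:E * (u w)%:E).
  by move=> mu; apply: emeasurable_funM => //; exact/measurable_EFinP.
rewrite ge0_integralD//; last 4 first.
- by move=> w _; rewrite lee_fin.
- exact/measurable_EFinP.
- by move=> w _; rewrite adde_ge0// mule_ge0// lee_fin.
- by apply: emeasurable_funD; exact: mZ.
congr (_ + _); rewrite ge0_integralD//; last 4 first.
- by move=> w _; rewrite mule_ge0// lee_fin.
- exact: mZ.
- by move=> w _; rewrite mule_ge0// lee_fin.
- exact: mZ.
congr (_ + _); rewrite ge0_integralZl//.
- exact/measurable_EFinP.
- by move=> w _; rewrite lee_fin.
- exact/measurable_EFinP.
- by move=> w _; rewrite lee_fin.
Qed.

Let sqdist t := \int[P]_w (`|y t w - xs| ^+ 2)%:E.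
Let mean_gap t := \int[P]_w (gapF (y t w))%:E.

(** [gradient_step] in the mean.  With the linear term split into its parts everything
    is nonnegative; the two parts have equal integrals, which cancel because they are
    finite. *)
Lemma sgd_one_step t : V < +oo -> sqdist t < +oo ->
  sqdist t.+1 + A%:E * mean_gap t <= sqdist t + B%:E * V.
Proof.
move=> Vfin afin; have [g2 [mg2 g20 g2E]] := measurable_sqr_grad.
have VE : V = \int[P]_w (g2 (X t w))%:E.
  rewrite (iid_integral X_iid t (f := fun j => (g2 j)%:E)).
  - apply: ge0_ae_eq_integral => [j|j|]; rewrite ?lee_fin ?sqr_ge0//.
    by apply: filterS g2E => j ->.
  - exact/measurable_EFinP.
  - by move=> j; rewrite lee_fin.
have g2X := iid_ae X_iid t g2E.
have [_ _ yx] := yP t; have [_ _ yx'] := yP t.+1.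
have msqr k : measurable_fun setT (fun w => `|y k w - xs| ^+ 2)%R.
  have [_ my _] := yP k.
  apply: (@measurable_caratheodory _ _ _ _ _ (fun v _ => `|v - xs| ^+ 2)%R my) => //.
  by move=> _ v; apply: cvgM; apply: cvg_norm; apply: cvgB;
    [exact: cvg_id|exact: cvg_cst|exact: cvg_id|exact: cvg_cst].
have mg2X : measurable_fun setT (fun w => g2 (X t w)) by exact: measurableT_comp.
have bE : mean_gap t = \int[P]_w (div (y t w) (X t w))%:E.
  rewrite (frozen t measurable_div continuous_div div_ge0).
  apply: eq_integral => w _; apply/esym.
  exact: (integral_bregman_gap L0 f_int f_convex f_smooth xs_min).
have partsE : \int[P]_w (ipos (y t w) (X t w))%:E = \int[P]_w (ineg (y t w) (X t w))%:E.
  rewrite (frozen t measurable_ipos continuous_ipos ipos_ge0).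
  rewrite (frozen t measurable_ineg continuous_ineg ineg_ge0).
  by apply: eq_integral => w _; exact: integral_ipos_ineg.
(* by Young's inequality the negative part is at most the two squares *)
have ineg_fin : \int[P]_w (ineg (y t w) (X t w))%:E \is a fin_num.
  rewrite ge0_fin_numE; last by apply: integral_ge0 => w _; rewrite lee_fin.
  apply: (@le_lt_trans _ _ (sqdist t + V)); last by rewrite lte_add_pinfty.
  have sqr0 w : setT w -> 0 <= (`|y t w - xs| ^+ 2)%:E.
    by rewrite lee_fin sqr_ge0.
  have g2X0 w : setT w -> 0 <= (g2 (X t w))%:E by rewrite lee_fin.
  have msqrt := proj2 (measurable_EFinP _ _) (msqr t).
  have mg2t := proj2 (measurable_EFinP _ _) mg2X.
  rewrite VE /sqdist -(ge0_integralD P measurableT sqr0 msqrt g2X0 mg2t).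
  apply: ge0_ae_le_integral => [w|w|].
  - by rewrite lee_fin.
  - by rewrite -EFinD lee_fin addr_ge0 ?sqr_ge0.
  apply: filterS g2X => w ->; rewrite -EFinD lee_fin ge_max.
  rewrite addr_ge0 ?sqr_ge0// andbT -innerNr.
  have := inner_le_sqr_norm (grad (f (X t w)) xs) (- (y t w - xs))%R.
  rewrite normrN; have := sqr_ge0 `|grad (f (X t w)) xs|%R.
  have := sqr_ge0 `|y t w - xs|%R.
  by move: (inner _ _) (_ ^+ 2)%R (_ ^+ 2)%R => q q1 q2; lra.
have step : sqdist t.+1 + (A%:E * mean_gap t
      + (2 * gamma)%:E * \int[P]_w (ipos (y t w) (X t w))%:E)
    <= sqdist t + (B%:E * V + (2 * gamma)%:E * \int[P]_w (ineg (y t w) (X t w))%:E).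
  have g0 : (0 <= 2 * gamma)%R by rewrite mulr_ge0// ltW.
  rewrite bE VE /sqdist -!integral_comb//; try exact: measurable_at;
    try by move=> w; exact: sqr_ge0.
  apply: ge0_ae_le_integral => [w|w|].
  - rewrite lee_fin; apply: addr_ge0; first exact: sqr_ge0.
    by apply: addr_ge0; apply: mulr_ge0.
  - rewrite lee_fin; apply: addr_ge0; first exact: sqr_ge0.
    by apply: addr_ge0; apply: mulr_ge0.
  apply: filterS2 g2X (filterI yx yx') => w -> [ytx ytx']; rewrite lee_fin.
  have := gradient_step (y t w) xs L0 gamma0 delta0 large (f_convex (X t w))
    (f_smooth (X t w)).
  have -> : (y t w - gamma *: grad (f (X t w)) (y t w))%R = y t.+1 w.
    by rewrite ytx ytx'.
  rewrite -/A -/B -(ipos_sub_ineg (y t w) (X t w)) /div.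
  move: (`|y t.+1 w - xs| ^+ 2)%R (`|y t w - xs| ^+ 2)%R (ipos _ _) (ineg _ _).
  move: (bregman _ _ _) (`|_| ^+ 2)%R A B.
  by move=> r1 r2 r3 r4 r5 r6 r7 r8; lra.
move: step; rewrite partsE !addeA leeD2rE//.
by rewrite fin_numM.
Qed.

Let sqdist_ge0 t : 0 <= sqdist t.
Proof. by apply: integral_ge0 => w _; rewrite lee_fin sqr_ge0. Qed.

Let mean_gap_ge0 t : 0 <= mean_gap t.
Proof. by apply: integral_ge0 => w _; rewrite lee_fin gap_ge0. Qed.

Lemma sgd_telescope T : V < +oo -> sqdist T < +oo /\
  sqdist T + A%:E * \sum_(0 <= t < T) mean_gap t
  <= (`|x0 - xs| ^+ 2)%:E + (T%:R * B)%:E * V.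
Proof.
move=> Vfin; have V0 : 0 <= V by apply: integral_ge0 => j _; rewrite lee_fin sqr_ge0.
elim: T => [|T [afin IH]].
  have aE : sqdist 0 = (`|x0 - xs| ^+ 2)%:E.
    have [_ _ yx] := yP 0.
    transitivity (\int[P]_w (`|x0 - xs| ^+ 2)%:E).
      apply: ge0_ae_eq_integral => [w|w|]; rewrite ?lee_fin ?sqr_ge0//.
      by apply: filterS yx => w ->.
    rewrite (integral_cst P measurableT (`|x0 - xs| ^+ 2)%:E) -[RHS]mule1.
    by congr (_ * _); exact: probability_setT.
  by rewrite aE ltry big_geq// mule0 adde0 mul0r mul0e adde0.
have step := sgd_one_step Vfin afin; split.
  apply: (@le_lt_trans _ _ (sqdist T + B%:E * V)).
    by apply: le_trans step; rewrite leeDl// mule_ge0// lee_fin.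
  by rewrite lte_add_pinfty// lte_mul_pinfty// lee_fin.
rewrite big_nat_recr//= ge0_muleDr//; last by apply: sume_ge0.
rewrite [_ + A%:E * mean_gap T]addeC addeA; apply: le_trans (leeD2r _ step) _.
rewrite addeAC; apply: le_trans (leeD2r _ IH) _.
have TB0 : 0 <= (T%:R * B)%:E by rewrite lee_fin; exact: mulr_ge0.
have BE0 : 0 <= B%:E by rewrite lee_fin.
rewrite -addeA -(ge0_muleDl _ TB0 BE0) -EFinD.
by rewrite -[in leLHS](mul1r B) mulrA mulr1 -mulrDl -natr1.
Qed.

Lemma sgd_gapE t : 'E_P[fun w => (objective D f (x t w) - minimum (objective D f))%R]
  = mean_gap t.
Proof.
rewrite unlock (minimum_argmin xs_min); apply: ge0_ae_eq_integral => [w|w|].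
- by rewrite lee_fin subr_ge0.
- by rewrite lee_fin gap_ge0.
- by have [_ _ yx] := yP t; apply: filterS yx => w <-.
Qed.

Lemma sgd_average_gap T : (0 < T)%N ->
  'E_P[fun w => (objective D f (average x T w) - minimum (objective D f))%R]
  <= T%:R^-1%:E * \sum_(0 <= t < T) mean_gap t.
Proof.
move=> T0; rewrite unlock (minimum_argmin xs_min).
have mgap t : measurable_fun setT (fun w => (gapF (y t w))%:E).
  have [_ my _] := yP t; apply/measurable_EFinP.
  apply: (@measurable_caratheodory _ _ _ _ _ (fun v _ => gapF v) my) => // w v.
  by apply: cvgB; [exact: differentiable_continuous|exact: cvg_cst].
rewrite -(ge0_integral_sum P measurableT mgap) => [|t w _]; last first.
  by rewrite lee_fin gap_ge0.
rewrite -ge0_integralZl//; last 2 first.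
- exact: emeasurable_sum.
- by move=> w _; apply: sume_ge0 => t _; rewrite lee_fin gap_ge0.
apply: ge0_ae_le_integral => [w|w|].
- by rewrite lee_fin subr_ge0.
- by rewrite mule_ge0// sume_ge0// => t _; rewrite lee_fin gap_ge0.
have : {ae P, forall w, forall t, y t w = x t w}.
  by apply: ae_foralln => t; case: (yP t).
apply: filterS => w yx; rewrite big_mkord sumEFin -EFinM lee_fin /average.
have -> : (\sum_(t < T) gapF (y t w) = \sum_(t < T) gapF (x t w))%R.
  by apply: eq_bigr => t _; rewrite yx.
rewrite /gapF /gap sumrB mulrBr sumr_const card_ord -(mulr_natl (objective D f xs)).
rewrite mulrA mulVf ?pnatr_eq0 -?lt0n// mul1r lerD2r.
exact: (objective_average L0 f_int f_convex f_smooth (fun t => x t w) T0).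
Qed.

End SGDProcess.

(** * The convergence bound *)

Theorem theorem4p12 (R : realType) (H : hilbertType R)
  (dI : measure_display) (I : measurableType dI) (D : probability I R)
  (f : I -> H -> R)
  (f_diff : forall i x, differentiable (f i) x)
  (f_int : forall x, D.-integrable setT (fun i => (f i x)%:E))
  (F_diff : forall x, differentiable (objective D f) x)
  (F_grad : forall x,
     has_expectation D (fun i => grad (f i) x) (grad (objective D f) x))
  (L : R) (L_gt0 : 0 < L)
  (f_convex : forall i, convex_function setT (f i))
  (f_smooth : forall i, smooth L (f i))
  (sigma_fin : (solution_grad_variance D f < +oo)%E)
  (gamma : R) (gamma_gt0 : 0 < gamma) (gammaL : 1 < gamma * L < 2)
  (dO : measure_display) (Omega : measurableType dO) (P : probability Omega R)
  (i : nat -> {mfun Omega >-> I}) (i_iid : iid P D i)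
  (x0 xs : H) (xs_argmin : argmin (objective D f) xs)
  (eps : R) (eps01 : 0 < eps < 1) (T : nat) (T_ge1 : (1 <= T)%N) :
  let F := objective D f in
  let x := sgd f gamma x0 i in
  let xbar := average x T in
  let avg_gap :=
    ((T%:R^-1)%:E *
     \sum_(0 <= t < T) 'E_P[fun w => (F (x t w) - minimum F)%R])%E in
  ('E_P[fun w => (F (xbar w) - minimum F)%R] <= avg_gap)%E /\
  (avg_gap <=
    (`|x0 - xs| ^+ 2 / (2 * gamma * (1 - eps) * (2 - gamma * L) * T%:R))%:E
    + ((gamma * L + eps * (2 - gamma * L))
         / (2 * eps * (1 - eps) * (2 - gamma * L) ^+ 2) * gamma)%:E
      * solution_grad_variance D f)%E.
Proof.
have [e0 e1] := andP eps01; have [gL1 gL2] := andP gammaL.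
have grad_int x : exists m, has_expectation D (fun j => grad (f j) x) m.
  by exists (grad (objective D f) x).
(* this makes [2 - gamma * L * (1 + delta)] equal to [(1 - eps) * (2 - gamma * L)] *)
pose delta := eps * (2 - gamma * L) / (gamma * L).
have gL0 : 0 < gamma * L by rewrite mulr_gt0.
have delta0 : 0 < delta by rewrite divr_gt0// mulr_gt0// subr_gt0.
have dE : gamma * L * (1 + delta) = gamma * L + eps * (2 - gamma * L).
  by rewrite /delta; field; rewrite !gt_eqF.
have large : 1 <= gamma * L * (1 + delta).
  rewrite dE (le_trans (ltW gL1))// lerDl.
  by apply: mulr_ge0; rewrite ?subr_ge0 ltW.
have sE : 2 - gamma * L * (1 + delta) = (1 - eps) * (2 - gamma * L).
  by rewrite dE; ring.
have small : gamma * L * (1 + delta) <= 2.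
  by rewrite -subr_ge0 sE; apply: mulr_ge0; rewrite subr_ge0 ltW.
have /choice[y yP] := sgd_version x0 xs L_gt0 gamma_gt0 f_smooth grad_int i_iid.
move=> F x xbar avg_gap.
set V := solution_grad_variance D f in sigma_fin *.
have V_le := grad_variance_argmin L_gt0 f_int f_convex f_smooth xs_argmin.
rewrite -/V in V_le; have V_fin := le_lt_trans V_le sigma_fin.
pose b t := (\int[P]_w (gap D f xs (y t w))%:E)%E.
have avgE : avg_gap = (T%:R^-1%:E * \sum_(0 <= t < T) b t)%E.
  congr (_ * _)%E; apply: eq_bigr => t _.
  exact: (sgd_gapE xs_argmin yP).
split.
  rewrite avgE.
  exact: (sgd_average_gap L_gt0 f_int f_convex f_smooth F_diff xs_argmin yP).
have [_ telescope] := sgd_telescope L_gt0 gamma_gt0 f_int f_convex f_smooth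
  grad_int xs_argmin i_iid delta0 large small yP T V_fin.
rewrite avgE; set A := 2 * gamma * _ in telescope.
have AE : A = 2 * gamma * (1 - eps) * (2 - gamma * L) by rewrite /A sE mulrA.
have A0 : 0 < A by rewrite AE !mulr_gt0 ?subr_gt0.
have T0 : 0 < T%:R :> R by rewrite ltr0n.
set S := (\sum_(0 <= t < T) b t)%E in telescope *.
set v := (\int[D]_j _)%E in V_le V_fin telescope.
have v0 : (0 <= v)%E by apply: integral_ge0 => j _; rewrite lee_fin sqr_ge0.
have VE : V = (fine V)%:E.
  by rewrite fineK// ge0_fin_numE// (le_trans v0 V_le).
rewrite VE in V_le *; move: (fine V) V_le => s V_le.
set B := gamma ^+ 2 * _ in telescope.
have B0 : 0 <= B by rewrite mulr_ge0 ?sqr_ge0// addr_ge0// invr_ge0 ltW.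
have AS : (A%:E * S <= (`|x0 - xs| ^+ 2 + T%:R * B * s)%:E)%E.
  apply: (@le_trans _ _ (\int[P]_w (`|y T w - xs| ^+ 2)%:E + A%:E * S)%E).
    by rewrite leeDr// integral_ge0// => w _; rewrite lee_fin sqr_ge0.
  apply: (le_trans telescope); rewrite EFinD leeD2lE// (EFinM (T%:R * B)).
  by apply: lee_wpmul2l V_le; rewrite lee_fin; apply: mulr_ge0 => //; exact: ltW.
have -> : (T%:R^-1%:E * S = (A * T%:R)^-1%:E * (A%:E * S))%E.
  by rewrite muleA -EFinM invfM mulrAC mulVf ?mul1r// gt_eqF.
apply: (@le_trans _ _ ((A * T%:R)^-1%:E * (`|x0 - xs| ^+ 2 + T%:R * B * s)%:E)%E).
  by apply: lee_wpmul2l => //; rewrite lee_fin invr_ge0; apply: mulr_ge0; exact: ltW.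
have [gN LN eN] : [/\ gamma != 0, L != 0 & eps != 0] by rewrite !gt_eqF.
have [e1N gLN TN] : [/\ 1 - eps != 0, 2 - gamma * L != 0 & T%:R != 0 :> R].
  by rewrite !gt_eqF ?subr_gt0.
rewrite -!EFinM -EFinD lee_fin AE /B /delta le_eqVlt.
apply/orP; left; apply/eqP.
by field; rewrite gLN e1N eN TN gN.
Qed.
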